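(* Let $A(x,t)$ be the $2m\times 2m$ matrix, polynomial in $x$, parametrized by $F=F(t)$, $G=G(t)$, $W=W(t)$ as described in the context (in particular $F^{-1}GFG^{-1}=\rho K$ holds), and let $B(x,t)$ be a matrix of the form $$B(x,t)=\frac{x(xI_{2m}+B_0)}{(x-qa_1t)(x-qa_2t)},$$ where $B_0=B_0(t)$ is a $2m\times 2m$ matrix independent of $x$. Then the compatibility condition $$A(x,qt)B(x,t)=B(qx,t)A(x,t)$$ (that is, the existence of a matrix $B_0$ for which this identity holds) is equivalent to the system $$\overline{F}KF=\frac{\theta_1\theta_2}{\kappa_1a_1a_2}\Big(\overline{G}-t\frac{a_1a_2}{\theta_1}\Big)\Big(\overline{G}-t\frac{a_1a_2}{\theta_2}\Big)\Big(\overline{G}-\frac{1}{q\kappa_1}\Big)^{-1}\big(\overline{G}-\rho\big)^{-1},$$ $$\overline{G}KG=\frac{1}{q\kappa_1}(F-a_1t)(F-a_2t)(F-a_3)^{-1}(F-a_4)^{-1},$$ $$W^{-1}\overline{W}=q\kappa_1(\overline{G}-K^{-1})^{-1}\Big(\overline{G}-\frac{1}{q\kappa_1}\Big)K^{-1}.$$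
   Context: Let $q\in\mathbb{C}$ with $0<|q|<1$ and let $m$ be a positive integer. The variable $t$ is a nonzero complex deformation parameter ranging over a set stable under $t\mapsto qt$; for a (matrix valued) function $M=M(t)$ write $\overline{M}=M(qt)$. A scalar $k$ added to or subtracted from an $m\times m$ matrix means $kI_m$. Parameters: $\theta_1,\theta_2,\kappa_1,\kappa_2,\kappa_3,a_1,a_2,a_3,a_4$ are nonzero complex constants (independent of $t$) subject to $$\kappa_1^m\kappa_2^{m-1}\kappa_3\prod_{i=1}^4a_i^m=\theta_1^m\theta_2^m .$$ The values $\theta_1,\theta_2$ are distinct, the values $\kappa_1,\kappa_2,\kappa_3$ are distinct, and no ratio $\theta_j/\theta_i$ or $\kappa_j/\kappa_i$ lies in $\{q^n: n\in\mathbb{Z}_{\ge1}\}$. Put $$K=\mathrm{diag}(\underbrace{\kappa_2,\dots,\kappa_2}_{m-1},\kappa_3),\qquad \rho=\frac{a_1a_2a_3a_4\kappa_1}{\theta_1\theta_2},$$ $$\alpha_1=a_1t,\quad \alpha_2=a_2t,\quad \alpha_3=a_3,\quad \alpha_4=a_4 .$$ The $\alpha_j$ are pairwise distinct and $q\alpha_i\neq\alpha_j$ for $i\ne j$. Define scalars $\beta_j$ by $\sum_{j=0}^4\beta_{4-j}x^j=\prod_{j=1}^4(x-\alpha_j)$. Let $F=F(t)$, $G=G(t)$, $W=W(t)$ be invertible $m\times m$ complex matrices, with $F,G$ satisfying the commutation relation $$F^{-1}GFG^{-1}=\rho K .$$ Put $$G_1=q^{-1}\kappa_1^{-1}(F-\alpha_1)(F-\alpha_2)G^{-1},\qquad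 G_2=q\kappa_1G(F-\alpha_3)(F-\alpha_4),$$ $$\boldsymbol{\alpha}=(\kappa_1-K)^{-1}\{(\theta_1+\theta_2)tF^{-1}-\kappa_1F^{-1}G_1-KG_2F^{-1}+K(F+G_1^{-1}FG_1+\beta_1)\},$$ $$\boldsymbol{\beta}=(\kappa_1-K)^{-1}\{-(\theta_1+\theta_2)tF^{-1}+\kappa_1F^{-1}G_1+KG_2F^{-1}-\kappa_1(F+G_1^{-1}FG_1+\beta_1)\},$$ $$\boldsymbol{\gamma}=K\{G_1+G_2+F\boldsymbol{\alpha}+\boldsymbol{\beta}F+\boldsymbol{\beta}\boldsymbol{\alpha}-G_1^{-1}(F^2+\beta_1F+\beta_2)G_1\}K^{-1},$$ $$\boldsymbol{\delta}=\kappa_1^{-1}\{t^2\theta_1\theta_2F^{-1}-\kappa_1K(G_2+\boldsymbol{\beta}F)F^{-1}(G_1+F\boldsymbol{\alpha})\}K^{-1}.$$ Then $A(x,t)$ is the block matrix (with $m\times m$ blocks) $$A(x,t)=\begin{pmatrix} WK\{\kappa_1(xI_m-F)(xI_m-\boldsymbol{\alpha})+\kappa_1G_1\}K^{-1}W^{-1} & WK(xI_m-F)\\ \kappa_1(\boldsymbol{\gamma}x+\boldsymbol{\delta})W^{-1} & K(xI_m-\boldsymbol{\beta})(xI_m-F)+KG_2\end{pmatrix}.$$ $A(x,qt)$ is obtained by replacing $t$ by $qt$ everywhere (including in $\alpha_1,\alpha_2$, the $\beta_j$, and $F,G,W$). All matrices whose inverses appear in these formulas are assumed invertible (generic situation);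 in particular $F-\alpha_j$ $(j=1,\dots,4)$, $\overline{G}-\frac{1}{q\kappa_1}$, $\overline{G}-\rho$, $\overline{G}-K^{-1}$ are invertible for all $t$ considered. *)

(* Defs.v *)
From mathcomp Require Import all_boot all_order all_algebra.
From mathcomp Require Import classical_sets reals complex.

Set Implicit Arguments.
Unset Strict Implicit.
Unset Printing Implicit Defensive.

Import GRing.Theory Num.Theory.

Local Open Scope ring_scope.

(* The block size is m = m'.+1, which makes 'M_m'.+1 a unit ring: products and
   inverses of m x m matrices are the (noncommutative) ring ones, and a scalar
   k added to a matrix is k%:M. *)

Record qpvi_params (C : Type) := QPVIParams {
  q : C;
  theta1 : C; theta2 : C;
  kappa1 : C; kappa2 : C; kappa3 : C;
  a1 : C; a2 : C; a3 : C; a4 : C }.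

Section LaxPair.

Context {C : fieldType} {m' : nat}.
Implicit Types (p : qpvi_params C) (t x : C) (F G : 'M[C]_m'.+1).

Definition thetas p := [:: theta1 p; theta2 p].
Definition kappas p := [:: kappa1 p; kappa2 p; kappa3 p].
Definition as_ p := [:: a1 p; a2 p; a3 p; a4 p].

Definition Kmx p : 'M[C]_m'.+1 :=
  diag_mx (\row_(i < m'.+1) if i == ord_max then kappa3 p else kappa2 p).

Definition rho p : C :=
  a1 p * a2 p * a3 p * a4 p * kappa1 p / (theta1 p * theta2 p).

(* alpha_1, ..., alpha_4, so that alpha_j is (alphas p t)`_j.-1 *)
Definition alphas p t : seq C := [:: a1 p * t; a2 p * t; a3 p; a4 p].

Definition beta_ p t (j : nat) : C :=
  (\prod_(a <- alphas p t) ('X - a%:P))`_(4 - j).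

Definition G1 p t F G : 'M[C]_m'.+1 :=
  ((q p)^-1 * (kappa1 p)^-1) *:
    ((F - (a1 p * t)%:M) * (F - (a2 p * t)%:M) * G^-1).

Definition G2 p F G : 'M[C]_m'.+1 :=
  (q p * kappa1 p) *: (G * (F - (a3 p)%:M) * (F - (a4 p)%:M)).

Definition balpha p t F G : 'M[C]_m'.+1 :=
  let K := Kmx p in let g1 := G1 p t F G in let g2 := G2 p F G in
  ((kappa1 p)%:M - K)^-1 *
    (((theta1 p + theta2 p) * t) *: F^-1 - kappa1 p *: (F^-1 * g1)
     - K * g2 * F^-1 + K * (F + g1^-1 * F * g1 + (beta_ p t 1)%:M)).

Definition bbeta p t F G : 'M[C]_m'.+1 :=
  let K := Kmx p in let g1 := G1 p t F G in let g2 := G2 p F G in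
  ((kappa1 p)%:M - K)^-1 *
    (- (((theta1 p + theta2 p) * t) *: F^-1) + kappa1 p *: (F^-1 * g1)
     + K * g2 * F^-1
     - kappa1 p *: (F + g1^-1 * F * g1 + (beta_ p t 1)%:M)).

Definition bgamma p t F G : 'M[C]_m'.+1 :=
  let K := Kmx p in let g1 := G1 p t F G in let g2 := G2 p F G in
  let al := balpha p t F G in let be := bbeta p t F G in
  K * (g1 + g2 + F * al + be * F + be * al
       - g1^-1 * (F ^+ 2 + beta_ p t 1 *: F + (beta_ p t 2)%:M) * g1) * K^-1.

Definition bdelta p t F G : 'M[C]_m'.+1 :=
  let K := Kmx p in let g1 := G1 p t F G in let g2 := G2 p F G in
  let al := balpha p t F G in let be := bbeta p t F G in
  (kappa1 p)^-1 *:
    (((t ^+ 2 * theta1 p * theta2 p) *: F^-1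
      - kappa1 p *: (K * (g2 + be * F) * F^-1 * (g1 + F * al))) * K^-1).

(* F, G, W are functions of t, so that A(x, qt) is laxA p F G W x (q p * t). *)
Definition laxA p (F G W : C -> 'M[C]_m'.+1) x t : 'M[C]_(m'.+1 + m'.+1) :=
  let K := Kmx p in
  let f := F t in let g := G t in let w := W t in
  let al := balpha p t f g in let be := bbeta p t f g in
  block_mx
    (w * K * (kappa1 p *: ((x%:M - f) * (x%:M - al)) + kappa1 p *: G1 p t f g)
       * K^-1 * w^-1)
    (w * K * (x%:M - f))
    (kappa1 p *: ((x *: bgamma p t f g + bdelta p t f g) * w^-1))
    (K * (x%:M - be) * (x%:M - f) + K * G2 p f g).

Definition poleB p t : seq C := [:: q p * a1 p * t; q p * a2 p * t].

(* Since 0^-1 = 0, this is the rational matrix B(x,t) only off poleB p t. *)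
Definition laxB p (B0 : 'M[C]_(m'.+1 + m'.+1)) x t : 'M[C]_(m'.+1 + m'.+1) :=
  (x / ((x - q p * a1 p * t) * (x - q p * a2 p * t))) *: (x%:M + B0).

End LaxPair.

(* Main.v *)
Require Import Defs.
From mathcomp Require Import all_boot all_order all_algebra.
From mathcomp Require Import classical_sets reals complex.
From mathcomp Require Import ring.

(** Write A = D M D^-1 with D = diag(W K, 1), and let b = D^-1 B0 D,
    V = (W K)^-1 (W' K), where a prime denotes the value at q t.  Clearing
    denominators, the compatibility condition becomes the vanishing of
      q (x - x1) (x - x2) M'(x) (x + b) - (x - q x1) (x - q x2) (q x + b) M(x),
    where x1 = a1 t, x2 = a2 t and M' is conjugated by diag(V, 1): a polynomial
    in x of degree 4.  At x = xi the
    matrix M has block rank one, so the vanishing at x1, x2 (resp. q x1, q x2)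
    says that the image of M(xi) consists of eigenvectors of b (resp. that
    q xi + b maps into the kernel of M'(q xi)).  Together with the coefficient
    of x^4, these conditions determine b and yield the equations for G and W;
    the equation for F is what remains of the (1,1) block at x = 0.
    Conversely, the three equations allow one to define b so that the
    polynomial vanishes at the five points 0, x1, x2, q x1, q x2.  The crux is
    that the images at xi and the kernels at q xi prescribe the same b11: one
    prescription involves beta at time t, the other alpha at time q t. *)

Set Implicit Arguments.
Unset Strict Implicit.
Unset Printing Implicit Defensive.

Import GRing.Theory Num.Theory.

Local Open Scope ring_scope.

(** * Identities in noncommutative algebras *)

(* [nc_field C A (H1, (H2, ... (Hn, tt)))] proves an equation in the C-algebra A
   by expanding both sides into words in the atoms, rewriting words with the
   equations Hi, each oriented from its left-hand side, which must be a product
   of atoms, and comparing the coefficients with [field].  Termination and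
   confluence of the rules are up to the caller; 60 bounds the depth of
   rewriting. *)

Inductive ncexpr (C : Type) :=
  | NVar of nat | NZero | NOne
  | NAdd of ncexpr C & ncexpr C | NOpp of ncexpr C
  | NMul of ncexpr C & ncexpr C | NScale of C & ncexpr C.

Arguments NVar {C}. Arguments NZero {C}. Arguments NOne {C}.

Section NCRing.
Variables (C : comNzRingType) (A : algType C).
Implicit Types (e : ncexpr C) (w : seq nat) (p : seq (C * seq nat)).

(** Separate copies of the list operations, so that the [cbv] of [nc_coeffs] computes on words and
    lists of terms while the coefficients in [C] stay untouched. *)
Fixpoint nc_eqw w1 w2 : bool :=
  match w1, w2 with
  | [::], [::] => true
  | i :: w1', j :: w2' => if Nat.eqb i j then nc_eqw w1' w2' else false
  | _, _ => false
  end.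

Fixpoint nc_cat T (s1 s2 : seq T) : seq T :=
  if s1 is x :: s1' then x :: nc_cat s1' s2 else s2.

Fixpoint nc_sandwich (c : C) w1 p w2 : seq (C * seq nat) :=
  match p with
  | [::] => [::]
  | (d, w) :: p' => (c * d, nc_cat w1 (nc_cat w w2)) :: nc_sandwich c w1 p' w2
  end.

Fixpoint nc_mul p1 p2 : seq (C * seq nat) :=
  match p1 with
  | [::] => [::]
  | (c, w) :: p1' => nc_cat (nc_sandwich c w p2 [::]) (nc_mul p1' p2)
  end.

Fixpoint nc_norm e : seq (C * seq nat) :=
  match e with
  | NVar i => [:: (1, [:: i])]
  | NZero => [::]
  | NOne => [:: (1, [::])]
  | NAdd e1 e2 => nc_cat (nc_norm e1) (nc_norm e2)
  | NOpp e1 => nc_sandwich (-1) [::] (nc_norm e1) [::]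
  | NMul e1 e2 => nc_mul (nc_norm e1) (nc_norm e2)
  | NScale c e1 => nc_sandwich c [::] (nc_norm e1) [::]
  end.

(** Meaningful only on products of atoms; the default [[::]] elsewhere is guarded by the test
    [nc_monomial] in [nc_head]. *)
Fixpoint nc_word e : seq nat :=
  match e with
  | NVar i => [:: i]
  | NMul e1 e2 => nc_cat (nc_word e1) (nc_word e2)
  | _ => [::]
  end.

Fixpoint nc_monomial e : bool :=
  match e with
  | NVar i => true
  | NMul e1 e2 => if nc_monomial e1 then nc_monomial e2 else false
  | _ => false
  end.

Fixpoint nc_prefix w1 w2 : option (seq nat) :=
  match w1, w2 with
  | [::], _ => Some w2
  | i :: w1', j :: w2' => if Nat.eqb i j then nc_prefix w1' w2' else None
  | _, _ => None
  end.

Fixpoint nc_head (rs : seq (ncexpr C * ncexpr C)) w :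
    option (seq (C * seq nat) * seq nat) :=
  match rs with
  | [::] => None
  | (l, r) :: rs' =>
    if nc_monomial l then
      match nc_prefix (nc_word l) w with
      | Some w' => Some (nc_norm r, w')
      | None => nc_head rs' w
      end
    else nc_head rs' w
  end.

Fixpoint nc_step rs w : option (seq nat * seq (C * seq nat) * seq nat) :=
  match nc_head rs w with
  | Some (p, w') => Some ([::], p, w')
  | None =>
    match w with
    | [::] => None
    | i :: w' =>
      match nc_step rs w' with
      | Some (w1, p, w2) => Some (i :: w1, p, w2)
      | None => None
      end
    end
  end.

(** The outer recursion is on the fuel [n], spent at each rewriting of a word, the inner one on the
    list of terms. Out of fuel, words are kept as they are, so the value is preserved for every
    [n]. *)
Fixpoint nc_reduce (n : nat) rs : seq (C * seq nat) -> seq (C * seq nat) :=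
  fix reduce p :=
  match p with
  | [::] => [::]
  | (c, w) :: p' =>
    match n with
    | 0 => (c, w) :: reduce p'
    | n'.+1 =>
      match nc_step rs w with
      | None => (c, w) :: reduce p'
      | Some (w1, q, w2) =>
        nc_cat (nc_reduce n' rs (nc_sandwich c w1 q w2)) (reduce p')
      end
    end
  end.

Fixpoint nc_insert (c : C) w p : seq (C * seq nat) :=
  match p with
  | [::] => [:: (c, w)]
  | (d, w') :: p' =>
    if nc_eqw w w' then (d + c, w') :: p' else (d, w') :: nc_insert c w p'
  end.

Fixpoint nc_collect p : seq (C * seq nat) :=
  match p with
  | [::] => [::]
  | (c, w) :: p' => nc_insert c w (nc_collect p')
  end.

Fixpoint nc_null p : Prop :=
  match p with
  | [::] => True
  | (c, _) :: p' => c = 0 /\ nc_null p'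
  end.

Variable env : seq A.

Fixpoint nc_var (s : seq A) (i : nat) : A :=
  match s, i with
  | [::], _ => 0
  | x :: _, 0 => x
  | _ :: s', i'.+1 => nc_var s' i'
  end.

Fixpoint nc_eval e : A :=
  match e with
  | NVar i => nc_var env i
  | NZero => 0
  | NOne => 1
  | NAdd e1 e2 => nc_eval e1 + nc_eval e2
  | NOpp e1 => - nc_eval e1
  | NMul e1 e2 => nc_eval e1 * nc_eval e2
  | NScale c e1 => c *: nc_eval e1
  end.

Fixpoint nc_evalw w : A :=
  if w is i :: w' then nc_var env i * nc_evalw w' else 1.

Fixpoint nc_evalp p : A :=
  if p is (c, w) :: p' then c *: nc_evalw w + nc_evalp p' else 0.

Fixpoint nc_valid (rs : seq (ncexpr C * ncexpr C)) : Prop :=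
  match rs with
  | [::] => True
  | (l, r) :: rs' => nc_eval l = nc_eval r /\ nc_valid rs'
  end.

Lemma nc_eqwP w1 w2 : nc_eqw w1 w2 -> w1 = w2.
Proof.
elim: w1 w2 => [|i w1 IH] [|j w2] //=.
by case: PeanoNat.Nat.eqb_spec => // -> /IH ->.
Qed.

Lemma nc_evalw_cat w1 w2 : nc_evalw (nc_cat w1 w2) = nc_evalw w1 * nc_evalw w2.
Proof. by elim: w1 => [|i w1 IH] /=; rewrite ?mul1r // IH mulrA. Qed.

Lemma nc_evalp_cat p1 p2 : nc_evalp (nc_cat p1 p2) = nc_evalp p1 + nc_evalp p2.
Proof. by elim: p1 => [|[c w] p1 IH] /=; rewrite ?add0r // IH addrA. Qed.

Lemma nc_evalp_sandwich c w1 p w2 :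
  nc_evalp (nc_sandwich c w1 p w2) = c *: (nc_evalw w1 * nc_evalp p * nc_evalw w2).
Proof.
elim: p => [|[d w] p IH] /=; first by rewrite mulr0 mul0r scaler0.
rewrite IH !nc_evalw_cat mulrDr mulrDl scalerDr.
by rewrite -scalerAr -scalerAl scalerA !mulrA.
Qed.

Lemma nc_evalp_mul p1 p2 : nc_evalp (nc_mul p1 p2) = nc_evalp p1 * nc_evalp p2.
Proof.
elim: p1 => [|[c w] p1 IH] /=; first by rewrite mul0r.
by rewrite nc_evalp_cat nc_evalp_sandwich IH mulr1 mulrDl scalerAl.
Qed.

Lemma nc_normP e : nc_evalp (nc_norm e) = nc_eval e.
Proof.
elim: e => [i|||e1 IH1 e2 IH2|e IH|e1 IH1 e2 IH2|c e IH] /=.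
- by rewrite mulr1 scale1r addr0.
- by [].
- by rewrite scale1r addr0.
- by rewrite nc_evalp_cat IH1 IH2.
- by rewrite nc_evalp_sandwich mul1r mulr1 IH scaleN1r.
- by rewrite nc_evalp_mul IH1 IH2.
- by rewrite nc_evalp_sandwich mul1r mulr1 IH.
Qed.

Lemma nc_wordP e : nc_monomial e -> nc_evalw (nc_word e) = nc_eval e.
Proof.
elim: e => //= [i _|e1 IH1 e2 IH2]; first by rewrite mulr1.
by case: nc_monomial IH1 => // /(_ isT) IH1 /IH2; rewrite nc_evalw_cat IH1 => ->.
Qed.

Lemma nc_prefixP w1 w2 w :
  nc_prefix w1 w2 = Some w -> nc_evalw w2 = nc_evalw w1 * nc_evalw w.
Proof.
elim: w1 w2 => [|i w1 IH] w2 /=; first by move=> [<-]; rewrite mul1r.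
case: w2 => [|j w2] //=.
by case: PeanoNat.Nat.eqb_spec => // -> /IH ->; rewrite mulrA.
Qed.

Lemma nc_headP rs w p w' : nc_valid rs -> nc_head rs w = Some (p, w') ->
  nc_evalw w = nc_evalp p * nc_evalw w'.
Proof.
elim: rs => [|[l r] rs IH] //= [lr /IH{}IH].
case ml: (nc_monomial l) => //.
case pw: (nc_prefix _ _) => [w''|//] [<- <-].
by rewrite (nc_prefixP pw) (nc_wordP ml) lr nc_normP.
Qed.

Lemma nc_stepP rs w w1 p w2 : nc_valid rs -> nc_step rs w = Some (w1, p, w2) ->
  nc_evalw w = nc_evalw w1 * nc_evalp p * nc_evalw w2.
Proof.
move=> vrs; elim: w w1 p w2 => [|i w IH] w1 p w2 /=;
  case hw: (nc_head _ _) => [[p' w']|] //.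
- by move=> [<- <- <-]; rewrite -[LHS]/(nc_evalw [::]) [LHS](nc_headP vrs hw) mul1r.
- by move=> [<- <- <-]; rewrite -[LHS]/(nc_evalw (i :: w)) [LHS](nc_headP vrs hw) mul1r.
case: (nc_step _ _) IH => [[[w1' p''] w2']|//] IH [<- <- <-].
by rewrite (IH _ _ _ erefl) /= !mulrA.
Qed.

Lemma nc_reduceP n rs p : nc_valid rs -> nc_evalp (nc_reduce n rs p) = nc_evalp p.
Proof.
move=> vrs; elim: n p => [|n IHn]; elim=> [|[c w] p IH] //=; first by rewrite IH.
case sw: (nc_step _ _) => [[[w1 r] w2]|/=]; last by rewrite IH.
by rewrite nc_evalp_cat IH IHn nc_evalp_sandwich -(nc_stepP vrs sw).
Qed.

Lemma nc_collectP p : nc_evalp (nc_collect p) = nc_evalp p.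
Proof.
have insP c w r : nc_evalp (nc_insert c w r) = c *: nc_evalw w + nc_evalp r.
  elim: r => [|[d w'] r IH] //=; case e: (nc_eqw w w') => /=.
    by rewrite (nc_eqwP e) scalerDl -addrA addrCA.
  by rewrite IH addrCA.
by elim: p => [|[c w] p IH] //=; rewrite insP IH.
Qed.

Lemma nc_nullP p : nc_null p -> nc_evalp p = 0.
Proof. by elim: p => [|[c w] p IH] //= [-> /IH ->]; rewrite scale0r addr0. Qed.

(** Every stage preserves the value, so vanishing of the collected coefficients suffices, however
    far the rewriting went. *)
Lemma nc_ringP n rs e1 e2 : nc_valid rs ->
  nc_null (nc_collect (nc_reduce n rs (nc_norm (NAdd e1 (NOpp e2))))) ->
  nc_eval e1 = nc_eval e2.
Proof.
move=> vrs /nc_nullP; rewrite nc_collectP (nc_reduceP _ _ vrs) nc_normP /=.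
by move/eqP; rewrite subr_eq0 => /eqP.
Qed.

End NCRing.

Ltac nc_add env x :=
  match env with
  | @nil ?T => constr:(@cons T x (@nil T))
  | cons x _ => env
  | @cons ?T ?y ?env' =>
    let env'' := nc_add env' x in constr:(@cons T y env'')
  end.

Ltac nc_vars env e :=
  lazymatch e with
  | @GRing.add _ ?a ?b => let env := nc_vars env a in nc_vars env b
  | @GRing.mul _ ?a ?b => let env := nc_vars env a in nc_vars env b
  | @GRing.opp _ ?a => nc_vars env a
  | @GRing.scale _ _ _ ?a => nc_vars env a
  | @GRing.zero _ => env
  | @GRing.one _ => env
  | _ => nc_add env e
  end.

Ltac nc_index env x :=
  match env with
  | cons x _ => constr:(0%N)
  | cons _ ?env' => let i := nc_index env' x in constr:(S i)
  end.

Ltac nc_reify C env e :=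
  lazymatch e with
  | @GRing.add _ ?a ?b =>
    let a := nc_reify C env a in let b := nc_reify C env b in constr:(@NAdd C a b)
  | @GRing.mul _ ?a ?b =>
    let a := nc_reify C env a in let b := nc_reify C env b in constr:(@NMul C a b)
  | @GRing.opp _ ?a => let a := nc_reify C env a in constr:(@NOpp C a)
  | @GRing.scale _ _ ?c ?a => let a := nc_reify C env a in constr:(@NScale C c a)
  | @GRing.zero _ => constr:(@NZero C)
  | @GRing.one _ => constr:(@NOne C)
  | _ => let i := nc_index env e in constr:(@NVar C i)
  end.

Ltac nc_hyps_vars env H :=
  lazymatch H with
  | tt => env
  | (?H1, ?H2) => let env := nc_hyps_vars env H1 in nc_hyps_vars env H2
  | _ => let T := type of H in lazymatch eval hnf in T with @eq _ ?l ?r =>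
           let env := nc_vars env l in nc_vars env r end
  end.

Ltac nc_hyps_reify C env rs H :=
  lazymatch H with
  | tt => rs
  | (?H1, ?H2) => let rs := nc_hyps_reify C env rs H2 in nc_hyps_reify C env rs H1
  | _ => let T := type of H in lazymatch eval hnf in T with @eq _ ?l ?r =>
           let l := nc_reify C env l in let r := nc_reify C env r in
           constr:(@cons (ncexpr C * ncexpr C) (l, r) rs) end
  end.

Ltac nc_hyps_proof pf H :=
  lazymatch H with
  | tt => pf
  | (?H1, ?H2) => let pf := nc_hyps_proof pf H2 in nc_hyps_proof pf H1
  | _ => constr:(conj H pf)
  end.

Ltac nc_coeffs C A H :=
  lazymatch goal with |- @eq ?T ?l ?r =>
    let env := nc_vars (@nil T) l in
    let env := nc_vars env r in
    let env := nc_hyps_vars env H in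
    let S := constr:(GRing.ComNzRing.sort C) in
    let l := nc_reify S env l in
    let r := nc_reify S env r in
    let rs := nc_hyps_reify S env (@nil (ncexpr S * ncexpr S)) H in
    let pf := nc_hyps_proof I H in
    refine (@nc_ringP C A env 60 rs l r pf _);
    cbv [nc_eqw nc_cat nc_sandwich nc_mul nc_norm nc_word nc_monomial nc_prefix
         nc_head nc_step nc_reduce nc_insert nc_collect nc_null Nat.eqb]
  end.

Ltac nc_field C A H :=
  nc_coeffs C A H; repeat split; try (by field; repeat (apply/andP; split)).

(** * The Lax matrix at a single time *)

(* The data of the context at one value of t: r is rho, s is
   (theta1 + theta2) t, c is theta1 theta2 t^2, xi is alpha_i, and gaK, deK are
   the products gamma K, delta K. *)
Record lax_data (C : fieldType) (A : unitAlgType C)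
    (q k1 r s c x1 x2 x3 x4 : C) (K F G G1 G2 al be gaK deK : A) : Prop := LaxData {
  ld_q : q != 0;
  ld_k1 : k1 != 0;
  ld_r : r != 0;
  ld_K : K \is a GRing.unit;
  ld_F : F \is a GRing.unit;
  ld_G : G \is a GRing.unit;
  ld_k1K : k1%:A - K \is a GRing.unit;
  ld_F1 : F - x1%:A \is a GRing.unit;
  ld_F2 : F - x2%:A \is a GRing.unit;
  ld_GF : G * F = r *: (F * K * G);
  ld_rc : r * c = k1 * x1 * x2 * x3 * x4;
  ld_G1 : G1 = (q^-1 * k1^-1) *: ((F - x1%:A) * (F - x2%:A) * G^-1);
  ld_G2 : G2 = (q * k1) *: (G * (F - x3%:A) * (F - x4%:A));
  ld_al : al = (k1%:A - K)^-1 *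
    (s *: F^-1 - k1 *: (F^-1 * G1) - K * G2 * F^-1
     + K * (F + G1^-1 * F * G1 + (- (x1 + x2 + x3 + x4))%:A));
  ld_be : be = (k1%:A - K)^-1 *
    (- (s *: F^-1) + k1 *: (F^-1 * G1) + K * G2 * F^-1
     - k1 *: (F + G1^-1 * F * G1 + (- (x1 + x2 + x3 + x4))%:A));
  ld_gaK : gaK = K * (G1 + G2 + F * al + be * F + be * al
    - G1^-1 * (F ^+ 2 + (- (x1 + x2 + x3 + x4)) *: F
       + (x1 * x2 + x1 * x3 + x1 * x4 + x2 * x3 + x2 * x4 + x3 * x4)%:A) * G1);
  ld_deK : deK = k1^-1 *: (c *: F^-1
    - k1 *: (K * (G2 + be * F) * F^-1 * (G1 + F * al))) }.

Section OneTime.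
Variables (C : fieldType) (A : unitAlgType C).
Variables (q k1 r s c x1 x2 x3 x4 : C) (K F G G1 G2 al be gaK deK : A).
Hypothesis h : lax_data q k1 r s c x1 x2 x3 x4 K F G G1 G2 al be gaK deK.

Let q0 := ld_q h. Let k10 := ld_k1 h. Let r0 := ld_r h.
Let uK := ld_K h. Let uF := ld_F h. Let uG := ld_G h.
Let uk1K := ld_k1K h.
Let GF := ld_GF h. Let G1E := ld_G1 h.
Local Notation b1 := (- (x1 + x2 + x3 + x4)).

Ltac nc H := nc_field C A H.

Let uG1 : G1 \is a GRing.unit.
Proof.
rewrite G1E scaler_unit ?unitfE ?mulf_neq0 ?invr_eq0 //.
by rewrite !unitrMl ?unitrV // ?(ld_F1 h, ld_F2 h).
Qed.

Let GiFK : G^-1 * F * K = r^-1 *: (F * G^-1).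
Proof.
apply: (mulrI uG); apply: (mulIr uG).
by nc (mulrV uG, (mulVr uG, (GF, tt))).
Qed.

Let GFi : G * F^-1 = r^-1 *: (K^-1 * F^-1 * G).
Proof.
apply: (mulrI uK); apply: (mulrI uF); apply: (mulIr uF).
by nc (mulVr uF, (mulrV uF, (mulrV uK, (GF, tt)))).
Qed.

(** [G1] is a polynomial in [F] times [G^-1], so conjugating [F] by it reduces to the commutation
    relation. This clears the inverse of [G1] from alpha, beta and gamma. *)
Let G1F : G1^-1 * F * G1 = r *: (F * K).
Proof.
apply: (mulrI uG1); rewrite -mulrA mulVKr //.
by rewrite G1E; nc (mulrV uG, (mulVr uG, (GiFK, tt))).
Qed.

Lemma alpha_eq : (k1%:A - K) * al =
  s *: F^-1 - k1 *: (F^-1 * G1) - K * G2 * F^-1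
  + K * (F + r *: (F * K) + b1%:A).
Proof. by rewrite (ld_al h) mulVKr // G1F. Qed.

Lemma beta_eq : (k1%:A - K) * be =
  - (s *: F^-1 - k1 *: (F^-1 * G1) - K * G2 * F^-1)
  - k1 *: (F + r *: (F * K) + b1%:A).
Proof. by rewrite (ld_be h) mulVKr // G1F; nc tt. Qed.

Let al_add_be : al = - (F + r *: (F * K) + b1%:A) - be.
Proof.
apply: (mulrI uk1K).
transitivity (- ((k1%:A - K) * (F + r *: (F * K) + b1%:A)) - (k1%:A - K) * be).
  by rewrite alpha_eq beta_eq; nc tt.
by rewrite mulrBr mulrN.
Qed.

(** In this combination the terms containing [F + r F K + b1] cancel, and the factor [k1 - K] can be
    divided out. *)
Lemma alpha_beta_residue :
  k1 *: al + K * be = s *: F^-1 - k1 *: (F^-1 * G1) - K * G2 * F^-1.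
Proof.
apply: (mulrI uk1K).
transitivity (k1 *: ((k1%:A - K) * al) + K * ((k1%:A - K) * be)); first by nc tt.
by rewrite alpha_eq beta_eq; nc tt.
Qed.

(** With [rank_one_11], this is the rank one factorization of M at x: both blocks of the first block
    column have the same right factor, and -1 takes its place in the second block column. Here y is
    the other one of the two points. *)
Lemma rank_one_21 x y : x = x1 /\ y = x2 \/ x = x2 /\ y = x1 ->
  k1 *: (x *: gaK + deK) = (K * (x%:A - be) * (F - x%:A) - K * G2)
    * (q^-1 *: ((F - y%:A) * G^-1) - k1 *: (x%:A - al)).
Proof.
have G1conj : G1^-1 * (F ^+ 2 + b1 *: F
       + (x1 * x2 + x1 * x3 + x1 * x4 + x2 * x3 + x2 * x4 + x3 * x4)%:A) * G1 =
    r *: (F * K) * (r *: (F * K)) + b1 *: (r *: (F * K))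
    + (x1 * x2 + x1 * x3 + x1 * x4 + x2 * x3 + x2 * x4 + x3 * x4)%:A.
  rewrite -G1F; apply: (mulrI uG1); rewrite expr2.
  by nc (mulrV uG1, tt).
have cE : c = k1 * x1 * x2 * x3 * x4 / r by rewrite -(ld_rc h); field.
rewrite (ld_gaK h) (ld_deK h) G1conj al_add_be G1E (ld_G2 h) cE => xy.
case: xy => -[-> ->];
by nc (mulrV uG, (mulVr uG, (mulrV uF, (mulVr uF, (mulVr uK, (mulrV uK,
  (GF, (GFi, tt)))))))).
Qed.

Lemma rank_one_11 x y : x = x1 /\ y = x2 \/ x = x2 /\ y = x1 ->
  k1 *: ((x%:A - F) * (x%:A - al) + G1) = (F - x%:A)
    * (q^-1 *: ((F - y%:A) * G^-1) - k1 *: (x%:A - al)).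
Proof. by rewrite G1E => -[] [-> ->]; nc tt. Qed.

Let p := k1 *: (F * al + G1).

Lemma residue_F : F^-1 * p = s *: F^-1 - K * G2 * F^-1 - K * be.
Proof.
transitivity (k1 *: al + K * be + k1 *: (F^-1 * G1) - K * be).
  by rewrite /p; nc (mulVr uF, tt).
by rewrite alpha_beta_residue; nc tt.
Qed.

Lemma const21 : k1 *: deK = c *: F^-1 - K * (G2 + be * F) * F^-1 * p.
Proof. by rewrite (ld_deK h) /p; nc tt. Qed.

(** Together with [const21], this writes the constant term of M through [p], [F] and the scalars
    [s], [c], as [lax0_sqr] requires. *)
Lemma const22 : K * (G2 + be * F) = s%:A - F^-1 * p * F.
Proof. by rewrite residue_F; nc (mulVr uF, tt). Qed.

End OneTime.

(** * Two consecutive times *)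

Section TwoTimes.
Variables (C : fieldType) (A : unitAlgType C).
Variables (q k1 r s c x1 x2 : C) (K F G2 be p f g p' r0 V b11 b12 b21 b22 : A).
Hypotheses (q0 : q != 0) (k10 : k1 != 0).
Hypotheses (x10 : x1 != 0) (x20 : x2 != 0) (x12 : x1 - x2 != 0).
Hypotheses (uF : F \is a GRing.unit) (ug : g \is a GRing.unit) (uV : V \is a GRing.unit)
  (uL : 1 - g * K \is a GRing.unit) (uN : 1 - (q * k1) *: g \is a GRing.unit).
Hypothesis gf : g * f = r *: (f * K * g).
Hypothesis Fp : F^-1 * p = s *: F^-1 - K * G2 * F^-1 - K * be.
Hypothesis p'E : p' = f * r0 + (q * x1 * x2) *: g^-1.

Ltac nc H := nc_field C A H.

(* In upper case the data at t, in lower case those at q t.  The matrix M(xi) is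
   the product of the column (F - xi, image_col xi) by a row ending in -1, and
   M'(q xi) is the product of a column by the row (kernel_row (q xi) V^-1, -1);
   p and p' are the (1,1) blocks of the constant terms, up to conjugation. *)
Definition image_col (x : C) : A := K * (x%:A - be) * (F - x%:A) - K * G2.
Definition kernel_row (x : C) : A := r0 + x *: (q^-1 *: g^-1 - k1%:A).
Definition const_m21 : A := c *: F^-1 - K * (G2 + be * F) * F^-1 * p.

(** * Necessity: the blocks of b and the equations for V and G2 *)

Section Forward.
Hypothesis E1 : q *: V + (q * k1) *: b12 = q%:A + b12 * K.
Hypothesis E2 : forall x, x \in [:: x1; x2] ->
  (b11 + (q * x)%:A) * (F - x%:A) + b12 * image_col x = 0.
Hypothesis E3 : forall x, x \in [:: x1; x2] ->
  kernel_row (q * x) * V^-1 * ((q * x)%:A + b11) = b21.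
Hypothesis E3' : forall x, x \in [:: x1; x2] ->
  kernel_row (q * x) * V^-1 * b12 = (q * x)%:A + b22.

Let m1 : x1 \in [:: x1; x2]. Proof. by rewrite !inE eqxx. Qed.
Let m2 : x2 \in [:: x1; x2]. Proof. by rewrite !inE eqxx orbT. Qed.
Let d0 : q * (x1 - x2) != 0. Proof. exact: mulf_neq0. Qed.

Lemma fwd_b12_V : V^-1 * b12 = q *: ((1 - (q * k1) *: g)^-1 * g).
Proof.
(* [kernel_row] is affine in x: subtracting the conditions at the two points isolates its slope. *)
have h : (q^-1 *: g^-1 - k1%:A) * V^-1 * b12 = 1.
  apply: (scalerI d0).
  transitivity (kernel_row (q * x1) * V^-1 * b12 - kernel_row (q * x2) * V^-1 * b12).
    by rewrite /kernel_row; nc tt.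
  by rewrite !E3' //; nc tt.
apply: (mulrI uN); rewrite -!scalerAr mulVKr //.
transitivity (q *: (g * ((q^-1 *: g^-1 - k1%:A) * V^-1 * b12))).
  by nc (mulrV ug, tt).
by rewrite h mulr1.
Qed.

Lemma fwd_V : (1 - g * K) * V = 1 - (q * k1) *: g.
Proof.
set Ni := (1 - (q * k1) *: g)^-1.
have NiN : Ni * g = (q * k1)^-1 *: (Ni - 1).
  apply: (mulrI uN); rewrite mulrA mulrV // mul1r -scalerAr mulrBr mulrV //.
  by nc tt.
have b12E : b12 = q *: (V * Ni * g).
  by rewrite -[LHS](mulVKr uV) fwd_b12_V -scalerAr !mulrA.
(* Since [1 + q k1 Ni g = Ni], the condition [E1] says that [V Ni] is inverse to [1 - g K]. *)
have VNL : V * Ni * (1 - g * K) = 1.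
  apply: (scalerI q0).
  transitivity (q *: V + (q * k1) *: b12 - b12 * K); last by rewrite E1 addrK.
  by rewrite b12E; nc (NiN, tt).
have VN : V * Ni = (1 - g * K)^-1 by apply: (mulIr uL); rewrite VNL mulVr.
by rewrite -[V](mulrVK uN) mulrA -/Ni -!mulrA (mulrA V) VN mulrA mulrV // mul1r.
Qed.

Lemma fwd_b12 : (1 - g * K) * b12 = q *: g.
Proof.
by rewrite -[b12](mulVKr uV) [LHS]mulrA fwd_V fwd_b12_V -scalerAr mulVKr.
Qed.

(** A divided difference of [E2]: the part [K G2] of [image_col], free of x, cancels. *)
Lemma fwd_b11 :
  b11 = q *: F + b12 * K * (F + be) - (x1 + x2) *: (q%:A + b12 * K).
Proof.
apply: (scalerI x12); apply/eqP; rewrite -subr_eq0; apply/eqP.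
transitivity (((b11 + (q * x2)%:A) * (F - x2%:A) + b12 * image_col x2)
  - ((b11 + (q * x1)%:A) * (F - x1%:A) + b12 * image_col x1)).
  by rewrite /image_col; nc tt.
by rewrite !E2 // subrr.
Qed.

(** What [E2] at one point still says once [b11] is substituted. Left multiplication by [1 - g K]
    turns [q + b12 K] into [q] and [b12 K] into [q g K]. *)
Lemma fwd_G2 : g * K * G2 = (F - x1%:A) * (F - x2%:A).
Proof.
have gKb : g * K * b12 = b12 - q *: g by rewrite -fwd_b12; nc tt.
have h : (q%:A + b12 * K) * ((F - x1%:A) * (F - x2%:A)) = b12 * K * G2.
  apply/eqP; rewrite -subr_eq0; apply/eqP; rewrite -(E2 m1) /image_col.
  by nc (fwd_b11, tt).
apply: (scalerI q0).
transitivity ((1 - g * K) * (b12 * K * G2)); first by nc (gKb, tt).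
by rewrite -h; nc (gKb, tt).
Qed.

Lemma fwd_r0 : r0 * V^-1 =
  - ((q^-1 *: g^-1 - k1%:A) * V^-1 * (b11 + (q * (x1 + x2))%:A)).
Proof.
apply: (scalerI d0); apply/eqP; rewrite -subr_eq0; apply/eqP.
transitivity (kernel_row (q * x1) * V^-1 * ((q * x1)%:A + b11)
  - kernel_row (q * x2) * V^-1 * ((q * x2)%:A + b11)).
  by rewrite /kernel_row; nc tt.
by rewrite !E3 // subrr.
Qed.

Lemma fwd_b21 : b21 =
  - ((q^-1 *: g^-1 - k1%:A) * V^-1 * (b11 + (q * x1)%:A) * (b11 + (q * x2)%:A)).
Proof. by rewrite -(E3 m1) /kernel_row; nc (fwd_r0, tt). Qed.

End Forward.

(** * Consequences of the formulas for V and b, shared by both directions *)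

Section Common.
Hypothesis LV : (1 - g * K) * V = 1 - (q * k1) *: g.
Hypothesis Lb : (1 - g * K) * b12 = q *: g.
Hypothesis b11E :
  b11 = q *: F + b12 * K * (F + be) - (x1 + x2) *: (q%:A + b12 * K).
Hypothesis gKG : g * K * G2 = (F - x1%:A) * (F - x2%:A).
(** From here to [gVi] the hypotheses are restated as rewriting rules for [nc_field], which
    eliminate the words [g K V], [K V], [K b12], [K G2], [g^-1 V^-1] and [g V^-1]. *)
Let gKV : g * K * V = V - 1 + (q * k1) *: g.
Proof. by transitivity (V - (1 - g * K) * V); [nc tt | rewrite LV; nc tt]. Qed.
Let KV : K * V = g^-1 * V - g^-1 + (q * k1)%:A.
Proof. by apply: (mulrI ug); nc (gKV, (mulrV ug, tt)). Qed.
Let Kb : K * b12 = g^-1 * b12 - q%:A.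
Proof.
apply: (mulrI ug); transitivity (b12 - q *: g); last by nc (mulrV ug, tt).
by rewrite -Lb; nc tt.
Qed.
Let KG : K * G2 = g^-1 * ((F - x1%:A) * (F - x2%:A)).
Proof. by rewrite -gKG; nc (mulVr ug, tt). Qed.
Let giVi : g^-1 * V^-1 = (q * k1) *: V^-1 + g^-1 - K.
Proof.
apply: (mulrI ug); apply: (mulIr uV).
by nc (mulrV ug, (mulVr uV, (mulrV uV, (gKV, tt)))).
Qed.
Let gVi : g * V^-1 = (q * k1)^-1 *: (V^-1 - 1 + g * K).
Proof.
apply: (mulIr uV).
by nc ((mulVr ug, (mulrV ug, (mulVr uV, (mulrV uV, (KV, tt)))))).
Qed.

(** The premise is what [consistency] provides: the constant part of the kernel row at time q t,
    expressed through beta at time t. *)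
Lemma r0_quotient : r0 = - ((g^-1 * F + K * be - (x1 + x2) *: K) * V) ->
  r0 * V^-1 = - ((q^-1 *: g^-1 - k1%:A) * V^-1 * (b11 + (q * (x1 + x2))%:A)).
Proof.
by move=> ->; rewrite b11E; nc (giVi, (Kb, (mulrV uV, tt))).
Qed.

Hypothesis r0V : r0 * V^-1 =
  - ((q^-1 *: g^-1 - k1%:A) * V^-1 * (b11 + (q * (x1 + x2))%:A)).
Hypothesis b21E : b21 =
  - ((q^-1 *: g^-1 - k1%:A) * V^-1 * (b11 + (q * x1)%:A) * (b11 + (q * x2)%:A)).

Definition const11_lhs := V * p' * V^-1 * b11 - V * f * b21.
Definition const11_rhs := q *: (b11 * p + b12 * const_m21).

(** Up to units and a nonzero scalar, the (1,1) block of the condition at x = 0 is the equation for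
    F without denominators. Being an identity, this serves both directions. *)
Lemma const11_reduce :
  (g * ((1 - g * K) * (const11_lhs - const11_rhs))) * F =
  (q * x1 * x2) *: ((1 - (q * k1) *: g) * (r%:A - g) * (f * K * F)
    - q *: (((x1 * x2)%:A - s *: g + (c / (x1 * x2)) *: (g * g)))).
Proof.
(* After substitution of [r0V] and [b21E], the terms following [V f] that are quadratic and linear
   in [b11] cancel; only the constant [q^2 x1 x2] remains there. *)
have hl : const11_lhs = (q ^+ 2 * x1 * x2) *: (V * f * (q^-1 *: (g^-1 - K)))
   + (q * x1 * x2) *: (V * g^-1 * V^-1 * b11).
  rewrite /const11_lhs p'E b21E.
  by nc (r0V, (giVi, tt)).
rewrite hl /const11_rhs /const_m21 b11E.
by nc (KV, (Kb, (KG, (giVi, (gVi, (mulrV uV, (mulVr ug, (mulrV ug, (mulrV uF,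
  (mulVr uF, (Fp, (gf, tt)))))))))))).
Qed.

Hypothesis b22E : b22 = r0 * V^-1 * b12.

Lemma bwd_kernel_b12 : (q^-1 *: g^-1 - k1%:A) * V^-1 * b12 = 1.
Proof. by nc (giVi, (Kb, tt)). Qed.

Lemma bwd_row1 x : x \in [:: x1; x2] ->
  kernel_row (q * x) * V^-1 * ((q * x)%:A + b11) = b21.
Proof. by rewrite !inE b21E /kernel_row => /orP[]/eqP->; nc (r0V, tt). Qed.

Lemma bwd_row2 x : kernel_row (q * x) * V^-1 * b12 = (q * x)%:A + b22.
Proof.
rewrite /kernel_row b22E.
transitivity (r0 * V^-1 * b12 + (q * x) *: ((q^-1 *: g^-1 - k1%:A) * V^-1 * b12)).
  by nc tt.
by rewrite bwd_kernel_b12; nc tt.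
Qed.

Lemma bwd_col1 x : x \in [:: x1; x2] ->
  (b11 + (q * x)%:A) * (F - x%:A) + b12 * image_col x = 0.
Proof.
have h : b12 * K * G2 = (q%:A + b12 * K) * ((F - x1%:A) * (F - x2%:A)).
  apply: (mulrI uL); transitivity ((1 - g * K) * b12 * (K * G2)); first by nc tt.
  rewrite Lb KG.
  by nc (Kb, (mulrV ug, (mulVr ug, tt))).
by rewrite !inE b11E /image_col => /orP[]/eqP->; nc (h, tt).
Qed.

(** Let y be the other point. By [w0], [image_col x] is the kernel row at [q y], times [V^-1],
    applied to [F - x]. Expanding [b21] and [b22] by the row identities at y then makes the second
    row of the condition a left multiple of the first. *)
Lemma bwd_col2 x : x \in [:: x1; x2] ->
  b21 * (F - x%:A) + (b22 + (q * x)%:A) * image_col x = 0.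
Proof.
move=> hx; pose y := x1 + x2 - x.
have hy : y \in [:: x1; x2].
  move: hx; rewrite /y !inE => /orP[]/eqP->.
    by rewrite addrAC subrr add0r eqxx orbT.
  by rewrite addrK eqxx.
have w0 : kernel_row (q * y) * V^-1 * (F - x%:A) = image_col x.
  rewrite /kernel_row /image_col.
  transitivity ((r0 * V^-1 + (q * y) *: ((q^-1 *: g^-1 - k1%:A) * V^-1)) * (F - x%:A)).
    by nc tt.
  have -> : (q^-1 *: g^-1 - k1%:A) * V^-1 = q^-1 *: (g^-1 - K) by nc (giVi, tt).
  rewrite r0V b11E; move: hx; rewrite /y !inE => /orP[]/eqP->;
  by nc (giVi, (Kb, (KG, (mulrV uV, tt)))).
rewrite -(bwd_row1 hy) addrC.
transitivity ((kernel_row (q * y) * V^-1 * b12) * image_col x + (q * (x - y)) *: image_col x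
  + kernel_row (q * y) * V^-1 * ((q * y)%:A + b11) * (F - x%:A)).
  by rewrite bwd_row2; nc tt.
transitivity (kernel_row (q * y) * V^-1
    * (b12 * image_col x + (b11 + (q * x)%:A) * (F - x%:A))
  + (q * (x - y)) *: (image_col x - kernel_row (q * y) * V^-1 * (F - x%:A))).
  by nc tt.
by rewrite w0 subrr scaler0 addr0 [b12 * _ + _]addrC bwd_col1 // mulr0.
Qed.

Lemma bwd_const2 : V * p' * V^-1 * b12 - V * f * b22 =
  q *: (b12 * (K * (G2 + be * F)) - b11 * F).
Proof.
rewrite p'E b22E b11E.
apply: (mulrI uL).
by nc (KV, (Kb, (KG, (giVi, (gVi, (mulrV uV, (mulVr uV, (mulVr ug, (mulrV ug, tt))))))))).
Qed.

End Common.
End TwoTimes.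

(** * Agreement of alpha at time q t with beta at time t *)

Section Consistency.
Variables (C : fieldType) (A : unitAlgType C).
Variables (q k1 r s c x1 x2 x3 x4 : C) (K F G f g : A) (be X al' X' : A).
Hypotheses (q0 : q != 0) (k10 : k1 != 0) (r0 : r != 0) (x10 : x1 != 0) (x20 : x2 != 0).
Hypotheses (uK : K \is a GRing.unit) (uF : F \is a GRing.unit)
  (uf : f \is a GRing.unit) (ug : g \is a GRing.unit) (uG : G \is a GRing.unit)
  (uk1K : k1%:A - K \is a GRing.unit).
Hypothesis GF : G * F = r *: (F * K * G).
Hypothesis gf : g * f = r *: (f * K * g).
Hypothesis rc : r * c = k1 * x1 * x2 * x3 * x4.
Let N : A := 1 - (q * k1) *: g.
Let L : A := 1 - g * K.
Variables (G2 V : A).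
Hypothesis G2E : G2 = (q * k1) *: (G * (F - x3%:A) * (F - x4%:A)).
Hypothesis LV : L * V = N.
Hypothesis gKG2 : g * K * G2 = (F - x1%:A) * (F - x2%:A).
Hypothesis eq1 : N * (r%:A - g) * (f * K * F)
  = q *: (((x1 * x2)%:A - s *: g + (c / (x1 * x2)) *: (g * g))).
Hypothesis XE : X = s *: F^-1
  - q^-1 *: (F^-1 * ((F - x1%:A) * (F - x2%:A)) * G^-1) - K * G2 * F^-1.
Hypothesis beE : (k1%:A - K) * be =
  - X - k1 *: (F + r *: (F * K) + (- (x1 + x2 + x3 + x4))%:A).
Hypothesis XE' : X' = (q * s) *: f^-1
  - q^-1 *: (f^-1 * ((f - (q * x1)%:A) * (f - (q * x2)%:A)) * g^-1)
  - (q * k1) *: (K * g * ((f - x3%:A) * (f - x4%:A)) * f^-1).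
Hypothesis alE' : (k1%:A - K) * al' =
  X' + K * (f + r *: (f * K) + (- (q * x1 + q * x2 + x3 + x4))%:A).

Ltac nc H := nc_field C A H.

Let cE : c = k1 * x1 * x2 * x3 * x4 / r.
Proof. by rewrite -rc; field. Qed.

(** By the equation for G, [g K G] is a rational function of [F] and so commutes with it. Comparison
    with [GF] carries the commutation relation over to the mixed pair [F], [g]. *)
Lemma Fg_comm : (F - x3%:A) * (F - x4%:A) \is a GRing.unit -> F * g = r *: (g * K * F).
Proof.
move=> u34; apply: (mulIr uK); apply: (mulIr uG); apply: (mulIr u34).
have e : g * K * G * ((F - x3%:A) * (F - x4%:A)) =
    (q * k1)^-1 *: ((F - x1%:A) * (F - x2%:A)).
  by rewrite -gKG2 G2E; nc tt.
transitivity (F * (g * K * G * ((F - x3%:A) * (F - x4%:A)))); first by nc tt.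
transitivity ((g * K * G * ((F - x3%:A) * (F - x4%:A))) * F); last by nc (GF, tt).
by rewrite e; nc tt.
Qed.

Hypothesis Fg : F * g = r *: (g * K * F).

Let KF : K * F = r^-1 *: (g^-1 * F * g).
Proof. by rewrite -mulrA Fg; nc (mulVr ug, tt). Qed.

Let KGE : K * G2 = g^-1 * ((F - x1%:A) * (F - x2%:A)).
Proof. by rewrite -gKG2; nc (mulVr ug, tt). Qed.

Let FgK : F^-1 * g * K = r^-1 *: (g * F^-1).
Proof.
apply: (mulrI uF); apply: (mulIr uF).
transitivity (r^-1 *: (F * g)); last by nc (mulVr uF, tt).
by rewrite Fg; nc (mulVr uF, (mulrV uF, tt)).
Qed.

Let f12G : (F - x1%:A) * (F - x2%:A) * G^-1 =
  (q * k1) *: ((F - x3%:A) * (F - x4%:A) * g * K).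
Proof.
apply: (mulIr uG); rewrite mulrVK // -gKG2 G2E.
have FgK' : F * g * K * G = g * K * G * F.
  by rewrite Fg; nc (GF, tt).
by nc (FgK', tt).
Qed.

Let fKg : f * K * g = r^-1 *: (g * f).
Proof. by rewrite gf; nc tt. Qed.

Let eq1' : N * (r%:A - g) * (f * K)
  = q *: (((x1 * x2)%:A - s *: g + (c / (x1 * x2)) *: (g * g))) * F^-1.
Proof. by rewrite -eq1; nc (mulrV uF, tt). Qed.

(** The point is the right factor [L]: since [L V = N], it makes [V] disappear from [consistency].
    The equation for F accounts for the term [s F^-1] of [X]. *)
Let bracket : - (k1%:A - K) * (g^-1 * F - (x1 + x2) *: K) + K * X
    + k1 *: (K * (F + r *: (F * K) + (- (x1 + x2 + x3 + x4))%:A)) =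
  (- k1 *: (g^-1 * F * (1 - r^-1 *: g)) + (x1 + x2) *: (K * g^-1)
    - (k1 * (x3 + x4)) *: K - (q^-1 * r) *: (K * g^-1 * N * f * K)) * L.
Proof.
transitivity ((- k1 *: (g^-1 * F * (1 - r^-1 *: g)) + (x1 + x2) *: (K * g^-1)
    - (k1 * (x3 + x4)) *: K) * L
   - q^-1 *: (K * g^-1 * (N * (r%:A - g) * (f * K)))); last first.
  by rewrite /N /L; nc (fKg, tt).
rewrite eq1' XE -[_ * _ * G^-1]mulrA f12G KGE cE.
by rewrite /L; nc (KF, (FgK, (mulVr uF, (mulrV uF, (mulVr ug, (mulrV ug, tt)))))).
Qed.

Lemma consistency :
  q^-1 *: ((f - (q * (x1 + x2))%:A) * g^-1) + k1 *: al' =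
  - ((g^-1 * F + K * be - (x1 + x2) *: K) * V).
Proof.
(* Multiplying by [k1 - K], which commutes with [K], replaces alpha and beta by their explicit
   numerators. *)
apply: (mulrI uk1K).
transitivity (q^-1 *: ((k1%:A - K) * ((f - (q * (x1 + x2))%:A) * g^-1))
  + k1 *: ((k1%:A - K) * al')).
  by nc tt.
rewrite alE'.
transitivity ((- (k1%:A - K) * (g^-1 * F - (x1 + x2) *: K)
    - K * ((k1%:A - K) * be)) * V); last first.
  by nc tt.
transitivity ((- (k1%:A - K) * (g^-1 * F - (x1 + x2) *: K) + K * X
    + k1 *: (K * (F + r *: (F * K) + (- (x1 + x2 + x3 + x4))%:A))) * V); last first.
  by rewrite beE; nc tt.
rewrite bracket -[_ * L * V]mulrA LV XE'.
have fgf : f^-1 * g * f = r *: (K * g).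
  by rewrite -mulrA gf; nc (mulVr uf, tt).
have fgif : f^-1 * g^-1 * f = r^-1 *: (g^-1 * K^-1).
  apply: (mulIr uK); apply: (mulIr ug); apply: (mulrI uf).
  transitivity (g^-1 * (f * K * g)); first by nc (mulrV uf, tt).
  by rewrite fKg; nc (mulVr ug, (mulVr uK, tt)).
have Kgf : K * g * f^-1 = r^-1 *: (f^-1 * g).
  by apply: (mulIr uf); nc (mulVr uf, (fgf, tt)).
have fgi : f * g^-1 = r *: (g^-1 * f * K).
  by apply: (mulIr ug); nc (mulVr ug, (fKg, tt)).
(* These are the terms of [X'] that contain [f^-1], once it is factored out on the left; the
   equation for F makes them divisible by [f] up to commutation. *)
have eq1'' : q *: (s%:A - (x1 * x2) *: g^-1 - (c / (x1 * x2)) *: g) =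
    - (g^-1 * (N * (r%:A - g) * (f * K * F))).
  by rewrite eq1; nc (mulVr ug, tt).
transitivity (k1 *: (f^-1 * (q *: (s%:A - (x1 * x2) *: g^-1 - (c / (x1 * x2)) *: g)))
  - q^-1 *: (K * (f - (q * (x1 + x2))%:A) * g^-1)
  - (q * k1 ^+ 2) *: (K * g * (f - (x3 + x4)%:A))
  + k1 *: (K * (f + r *: (f * K) + (- (q * x1 + q * x2 + x3 + x4))%:A))).
  by rewrite cE; nc (mulVr uf, (mulrV uf, (Kgf, tt))).
rewrite eq1'' /N.
by nc (mulVr uf, (mulrV uf, (mulVr ug, (mulrV ug, (mulVr uK,
  (fgf, (fgif, (fgi, (fKg, (KF, tt)))))))))).
Qed.
End Consistency.

(** * Reduction to a polynomial identity *)

Lemma mx_coefs_eq0 (C : fieldType) (a b : nat) (P xs : seq _) :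
  uniq xs -> (size P <= size xs)%N ->
  (forall x : C, x \in xs -> \sum_(k < size P) x ^+ k *: (P`_k : 'M[C]_(a, b)) = 0) ->
  forall k, P`_k = 0.
Proof.
move=> uxs sP h k; apply/matrixP => i j; rewrite [RHS]mxE.
have [kP|Pk] := ltnP k (size P); last by rewrite nth_default ?mxE.
pose f : {poly C} := \poly_(l < size P) P`_l i j.
suff f0 : f = 0 by move: (congr1 (fun g : {poly C} => g`_k) f0); rewrite coef_poly kP coef0.
apply: (@roots_geq_poly_eq0 _ _ xs) => //; last first.
  exact: leq_trans (size_poly _ _) _.
apply/allP => x /h /matrixP /(_ i j); rewrite summxE mxE => hx.
rewrite /root horner_poly -[X in _ == X]hx; apply/eqP/eq_bigr => l _.
by rewrite mxE mulrC.
Qed.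

Lemma exists_notin (C : numDomainType) (n : nat) (bad : seq C) :
  exists xs : seq C, [/\ uniq xs, (n <= size xs)%N & forall x, x \in xs -> x \notin bad].
Proof.
(* Natural numbers remain distinct in [C], and at most [size bad] of these are excluded. *)
pose s := [seq i%:R : C | i <- iota 0 (n + size bad)].
have us : uniq s by rewrite map_inj_uniq ?iota_uniq // => i j /eqP; rewrite eqr_nat => /eqP.
exists [seq x <- s | x \notin bad]; split; first exact: filter_uniq.
  have := count_predC (mem bad) s; rewrite size_map size_iota -!size_filter => e.
  have le : (size [seq x <- s | x \in bad] <= size bad)%N.
    by apply: uniq_leq_size; [exact: filter_uniq | move=> x; rewrite mem_filter => /andP[]].
  by rewrite -(leq_add2l (size [seq x <- s | x \in bad])) [leqRHS]e addnC leq_add2l.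
by move=> x; rewrite mem_filter => /andP[].
Qed.

Section Pencil.
Variables (C : fieldType) (A : algType C) (q x1 x2 : C) (M2 M1 M0 N1 N0 b : A).
Ltac nc H := nc_field C A H.

Definition quad (R2 R1 R0 : A) (x : C) : A := x ^+ 2 *: R2 + x *: R1 + R0.

(** The compatibility condition times [q (x - x1) (x - x2) (x - q x1) (x - q x2) / x]. Both
    quadratics have leading coefficient [M2], so the terms in x^5 cancel and five coefficients
    remain. *)
Definition pencil (x : C) : A :=
  (q * (x - x1) * (x - x2)) *: (quad M2 N1 N0 x * (x%:A + b))
  - ((x - q * x1) * (x - q * x2)) *: (((q * x)%:A + b) * quad M2 M1 M0 x).

Definition pencil_coefs : seq A :=
  let s := x1 + x2 in let p := x1 * x2 in
  let l2 := N1 + M2 * b in let l1 := N0 + N1 * b in let l0 := N0 * b in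
  let r2 := q *: M1 + b * M2 in let r1 := q *: M0 + b * M1 in let r0 := b * M0 in
  [:: (q * p) *: l0 - (q ^+ 2 * p) *: r0;
      (q * p) *: l1 - (q * s) *: l0 - (q ^+ 2 * p) *: r1 + (q * s) *: r0;
      (q * p) *: l2 - (q * s) *: l1 + q *: l0
        - (q ^+ 2 * p) *: r2 + (q * s) *: r1 - r0;
      (q * p) *: M2 - (q * s) *: l2 + q *: l1
        - (q ^+ 3 * p) *: M2 + (q * s) *: r2 - r1;
      q *: (N1 + M2 * b) - (q * s) *: M2 - (q *: M1 + b * M2) + (q ^+ 2 * s) *: M2].

Lemma pencilE x : pencil x = \sum_(k < 5) x ^+ k *: pencil_coefs`_k.
Proof.
rewrite !big_ord_recl big_ord0 /= /pencil /quad /pencil_coefs /=.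
by nc tt.
Qed.
End Pencil.

Lemma pencil_eq0 (C : fieldType) (n : nat) (q x1 x2 : C) (M2 M1 M0 N1 N0 b : 'M[C]_n.+1)
    (xs : seq C) : uniq xs -> (5 <= size xs)%N ->
  (forall x, x \in xs -> pencil q x1 x2 M2 M1 M0 N1 N0 b x = 0) ->
  (forall x, pencil q x1 x2 M2 M1 M0 N1 N0 b x = 0) /\
  q *: (N1 + M2 * b) - (q * (x1 + x2)) *: M2 - (q *: M1 + b * M2)
    + (q ^+ 2 * (x1 + x2)) *: M2 = 0.
Proof.
move=> uxs sxs h.
have P0 : forall k, (pencil_coefs q x1 x2 M2 M1 M0 N1 N0 b)`_k = 0.
  apply: (@mx_coefs_eq0 _ _ _ _ xs) => // x /h.
  by rewrite pencilE.
split=> [x|]; last exact: (P0 4).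
by rewrite pencilE big1 // => k _; rewrite P0 scaler0.
Qed.

(* With a single algebra structure on the blocks, atoms are equal exactly when
   they are syntactically equal, as [nc_field] requires. *)
Definition mxalg (C : fieldType) (m' : nat) : unitAlgType C := 'M[C]_m'.+1.

(** * Two by two block matrices as ring elements *)

Section Blocks.
Variables (C : fieldType) (m' : nat).
Notation M := (mxalg C m').
Implicit Types a b c d : M.

(** The size is convertible to [m'.+1 + m'.+1]; its successor form gives access to the ring
    structure on square matrices. *)
Definition blk a b c d : 'M[C]_((m' + m'.+1).+1) := block_mx a b c d.

Lemma blkM a b c d a' b' c' d' : blk a b c d * blk a' b' c' d' =
  blk (a * a' + b * c') (a * b' + b * d') (c * a' + d * c') (c * b' + d * d').
Proof. exact: (@mulmx_block _ m'.+1 m'.+1 m'.+1 m'.+1 m'.+1 m'.+1). Qed.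

Lemma blkD a b c d a' b' c' d' :
  blk a b c d + blk a' b' c' d' = blk (a + a') (b + b') (c + c') (d + d').
Proof. exact: (@add_block_mx _ m'.+1 m'.+1 m'.+1 m'.+1). Qed.

Lemma blkZ (k : C) a b c d :
  k *: blk a b c d = blk (k *: a) (k *: b) (k *: c) (k *: d).
Proof. exact: (@scale_block_mx _ m'.+1 m'.+1 m'.+1 m'.+1). Qed.

Lemma blkN a b c d : - blk a b c d = blk (- a) (- b) (- c) (- d).
Proof. exact: (@opp_block_mx _ m'.+1 m'.+1 m'.+1 m'.+1). Qed.

Lemma blk_scalar (k : C) : k%:A = blk k%:A 0 0 k%:A.
Proof.
rewrite scalemx1 -[k%:A : M]/(k *: 1%:M : 'M[C]_m'.+1) scalemx1.
exact: (@scalar_mx_block _ m'.+1 m'.+1).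
Qed.

Lemma blk_inj a b c d a' b' c' d' : blk a b c d = blk a' b' c' d' ->
  [/\ a = a', b = b', c = c' & d = d'].
Proof. exact: (@eq_block_mx _ m'.+1 m'.+1 m'.+1 m'.+1). Qed.

Lemma blk0 : 0 = blk 0 0 0 0.
Proof. by apply/esym; exact: (@block_mx0 _ m'.+1 m'.+1 m'.+1 m'.+1). Qed.

Lemma blk_surj (X : 'M[C]_((m' + m'.+1).+1)) : exists a b c d, X = blk a b c d.
Proof.
pose Y : 'M[C]_(m'.+1 + m'.+1) := X.
exists (ulsubmx Y), (ursubmx Y), (dlsubmx Y), (drsubmx Y).
exact/esym/(@submxK _ m'.+1 m'.+1 m'.+1 m'.+1 Y).
Qed.

Lemma blk_diag_unit a : a \is a GRing.unit ->
  blk a 0 0 1 \is a GRing.unit /\ (blk a 0 0 1)^-1 = blk a^-1 0 0 1.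
Proof.
move=> ua.
have e1 : blk a 0 0 1 * blk a^-1 0 0 1 = 1.
  by rewrite blkM mulrV // !mul0r !mulr0 !mul1r !addr0 !add0r
       -[RHS]scale1r blk_scalar !scale1r.
have e2 : blk a^-1 0 0 1 * blk a 0 0 1 = 1.
  by rewrite blkM mulVr // !mul0r !mulr0 !mul1r !addr0 !add0r
       -[RHS]scale1r blk_scalar !scale1r.
have u : blk a 0 0 1 \is a GRing.unit by apply/unitrP; exists (blk a^-1 0 0 1).
by split=> //; apply: (mulrI u); rewrite e1 mulrV.
Qed.
End Blocks.

Section Gauge.
Variables (C : fieldType) (A : unitAlgType C) (q x1 x2 : C) (M2 M1 M0 N1 N0 B0 D : A).
Hypothesis uD : D \is a GRing.unit.
Ltac nc H := nc_field C A H.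
Let b := D^-1 * B0 * D.

Lemma compat_pencil x : q != 0 -> x != 0 -> x - x1 != 0 -> x - x2 != 0 ->
  x - q * x1 != 0 -> x - q * x2 != 0 ->
  (D * quad M2 N1 N0 x * D^-1) * ((x / ((x - q * x1) * (x - q * x2))) *: (x%:A + B0))
  = ((q * x / ((q * x - q * x1) * (q * x - q * x2))) *: ((q * x)%:A + B0))
     * (D * quad M2 M1 M0 x * D^-1)
  <-> pencil q x1 x2 M2 M1 M0 N1 N0 b x = 0.
Proof.
move=> q0 x0 d1 d2 d3 d4.
rewrite /pencil; move: (quad _ _ _ x) (quad _ _ _ x) => N M.
set l := LHS; set r := RHS.
have d1' : q * x - q * x1 != 0 by rewrite -mulrBr mulf_neq0.
have d2' : q * x - q * x2 != 0 by rewrite -mulrBr mulf_neq0.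
pose k := x / (q * (x - q * x1) * (x - q * x2) * (x - x1) * (x - x2)).
have k0 : k != 0 by rewrite /k mulf_neq0 ?invr_eq0 // ?mulf_neq0.
set P := (X in _ <-> X = 0).
have e : l - r = k *: (D * P * D^-1).
  by rewrite /l /r /P /b /k; nc (mulVr uD, (mulrV uD, tt)).
split=> [lr|P0]; last by apply/eqP; rewrite -subr_eq0 e P0 mulr0 mul0r scaler0.
have /eqP : k *: (D * P * D^-1) = 0 by rewrite -e lr subrr.
rewrite scaler_eq0 (negPf k0) /= => /eqP h.
have uDi : D^-1 \is a GRing.unit by rewrite unitrV.
by apply: (mulrI uD); apply: (mulIr uDi); rewrite h mulr0 mul0r.
Qed.
End Gauge.

(* If the first row of S vanishes, so does that of N S, hence the second row of
   S too when the upper right block of N is invertible: at x = 0 it suffices to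
   check the first row. *)
Lemma quadratic_intertwine (C : fieldType) (A : algType C) (q s c : C) (N L b : A) :
  N * N = (q * s) *: N - (q ^+ 2 * c)%:A -> L * L = s *: L - c%:A ->
  let S := N * b - q *: (b * L) in N * S = (q * s) *: S - q *: (S * L).
Proof.
by move=> NN LL /=; nc_field C A (NN, (LL, tt)).
Qed.

Lemma quad_conj (C : fieldType) (A : unitAlgType C) (u M2 M1 M0 : A) :
  u * M2 * u^-1 = M2 -> forall x : C,
  quad M2 (u * M1 * u^-1) (u * M0 * u^-1) x = u * quad M2 M1 M0 x * u^-1.
Proof.
move=> uM2 x; rewrite /quad -{1}uM2 !mulrDr !mulrDl.
by rewrite -!scalerAr -!scalerAl.
Qed.

(** * The compatibility condition in block form *)

Section LaxBlocks.
Variables (C : fieldType) (m' : nat).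
Notation M := (mxalg C m').
Variables (k1 : C) (K F al be G1 G2 gaK deK : M).

Ltac nc H := nc_field C (mxalg C m') H.

Definition lax2 := blk k1%:A 0 0 K.
Definition lax1 := blk (- (k1 *: (F + al))) 1 (k1 *: gaK) (- (K * (be + F))).
Definition lax0 :=
  blk (k1 *: (F * al + G1)) (- F) (k1 *: deK) (K * (G2 + be * F)).

Lemma quad_laxE x : quad lax2 lax1 lax0 x =
  blk (k1 *: ((x%:A - F) * (x%:A - al) + G1)) (x%:A - F)
      (k1 *: (x *: gaK + deK)) (K * (x%:A - be) * (x%:A - F) + K * G2).
Proof.
by rewrite /quad !blkZ !blkD; congr blk; nc tt.
Qed.

(** A Cayley-Hamilton identity with scalar coefficients. It is used with [t] and [d] equal to [s]
    and [c], when the roots of the quadratic are theta1 and theta2 times the time variable. *)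
Lemma lax0_sqr t d : F \is a GRing.unit ->
  k1 *: deK = d *: F^-1 - K * (G2 + be * F) * F^-1 * (k1 *: (F * al + G1)) ->
  K * (G2 + be * F) = t%:A - F^-1 * (k1 *: (F * al + G1)) * F ->
  lax0 * lax0 = t *: lax0 - d%:A.
Proof.
move=> uF e21 e22; rewrite blk_scalar /lax0 e21 e22.
move: (k1 *: (F * al + G1)) => p.
by rewrite !blkM !blkZ blkN blkD; congr blk; nc (mulrV uF, (mulVr uF, tt)).
Qed.

Lemma lax2_conj V : V \is a GRing.unit ->
  blk V 0 0 1 * lax2 * (blk V 0 0 1)^-1 = lax2.
Proof.
move=> uV; rewrite (blk_diag_unit uV).2 /lax2 !blkM.
by congr blk; nc (mulrV uV, tt).
Qed.
End LaxBlocks.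

(** * The pencil of the Lax pair and the three equations *)

Section PencilBlocks.
Variables (C : fieldType) (m' : nat).
Notation M := (mxalg C m').
Variables (q k1 r s c x1 x2 x3 x4 : C) (K F G G1 G2 al be gaK deK : M).
Variables (f g g1 g2 al' be' gaK' deK' V : M).
Hypothesis h : lax_data q k1 r s c x1 x2 x3 x4 K F G G1 G2 al be gaK deK.
Hypothesis h' : lax_data q k1 r (q * s) (q ^+ 2 * c) (q * x1) (q * x2) x3 x4
  K f g g1 g2 al' be' gaK' deK'.
Hypothesis uV : V \is a GRing.unit.
Hypotheses (x10 : x1 != 0) (x20 : x2 != 0) (x12 : x1 - x2 != 0).
Hypotheses (x1q1 : x1 - q * x1 != 0) (x1q2 : x1 - q * x2 != 0)
  (x2q1 : x2 - q * x1 != 0) (x2q2 : x2 - q * x2 != 0).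
Hypotheses (uL : 1 - g * K \is a GRing.unit) (uN : 1 - (q * k1) *: g \is a GRing.unit)
  (u34 : (F - x3%:A) * (F - x4%:A) \is a GRing.unit).

Ltac nc H := nc_field C (mxalg C m') H.

Local Notation u := (blk V 0 0 1).
Let uu : u \is a GRing.unit := (blk_diag_unit uV).1.
Let ui : u^-1 = blk V^-1 0 0 1 := (blk_diag_unit uV).2.
Definition lax_bar1 := u * lax1 k1 K f al' be' gaK' * u^-1.
Definition lax_bar0 := u * lax0 k1 K f al' be' g1 g2 deK' * u^-1.
Definition lax_pencil b := pencil q x1 x2 (lax2 k1 K) (lax1 k1 K F al be gaK)
  (lax0 k1 K F al be G1 G2 deK) lax_bar1 lax_bar0 b.

(** At time q t the other point is [q (x1 + x2) - x], so the right factor in [rank_one_11] is affine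
    in x; this is its constant term. *)
Let r0 := q^-1 *: ((f - (q * (x1 + x2))%:A) * g^-1) + k1 *: al'.
Let p := k1 *: (F * al + G1).
Let p' := k1 *: (f * al' + g1).
Let q0 := ld_q h. Let k10 := ld_k1 h. Let rn0 := ld_r h.
Let uK := ld_K h. Let uF := ld_F h. Let uG := ld_G h.
Let uf := ld_F h'. Let ug := ld_G h'.

Let Fp : F^-1 * p = s *: F^-1 - K * G2 * F^-1 - K * be := residue_F h.
Let p'E : p' = f * r0 + (q * x1 * x2) *: g^-1.
Proof. by rewrite /p' /r0 (ld_G1 h'); nc tt. Qed.
Let m21E : k1 *: deK = const_m21 c K F G2 be p := const21 h.

Let quadN x : quad (lax2 k1 K) lax_bar1 lax_bar0 x =
  u * quad (lax2 k1 K) (lax1 k1 K f al' be' gaK') (lax0 k1 K f al' be' g1 g2 deK') x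
    * u^-1.
Proof. exact: quad_conj (lax2_conj k1 K uV) x. Qed.

Let quadNE x : quad (lax2 k1 K) lax_bar1 lax_bar0 x =
  blk (V * (k1 *: ((x%:A - f) * (x%:A - al') + g1)) * V^-1) (V * (x%:A - f))
      (k1 *: (x *: gaK' + deK') * V^-1) (K * (x%:A - be') * (x%:A - f) + K * g2).
Proof.
rewrite quadN quad_laxE ui !blkM.
by congr blk; rewrite ?(mul0r, mulr0, addr0, add0r, mul1r, mulr1).
Qed.

Lemma pencil_eq0_equations b (xs : seq C) : uniq xs -> (5 <= size xs)%N ->
  (forall x, x \in xs -> lax_pencil b x = 0) ->
  [/\ (1 - g * K) * V = 1 - (q * k1) *: g,
      g * K * G2 = (F - x1%:A) * (F - x2%:A)
    & (1 - (q * k1) *: g) * (r%:A - g) * (f * K * F)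
      = q *: ((x1 * x2)%:A - s *: g + (c / (x1 * x2)) *: (g * g))].
Proof.
move=> uxs sxs hxs; have [Px P4] := pencil_eq0 uxs sxs hxs.
have [b11 [b12 [b21 [b22 bE]]]] := blk_surj b; rewrite bE in Px P4.
set b' := blk b11 b12 b21 b22 in Px P4.
(* The (1,2) block of the coefficient of x^4. *)
have E1 : q *: V + (q * k1) *: b12 = q%:A + b12 * K.
  move: P4; rewrite /lax_bar1 ui /lax2 /lax1 /b' !(blkM, blkZ, blkD, blkN) blk0.
  case/blk_inj => _ e _ _; apply/eqP; rewrite -subr_eq0 -e; apply/eqP.
  by nc tt.
have colP x : x \in [:: x1; x2] -> ((q * x)%:A + b')
    * quad (lax2 k1 K) (lax1 k1 K F al be gaK) (lax0 k1 K F al be G1 G2 deK) x = 0.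
  move=> hx; have := Px x; rewrite /pencil.
  have [d e] : (x - q * x1) * (x - q * x2) != 0 /\ q * (x - x1) * (x - x2) = 0.
    move: hx; rewrite !inE => /orP[]/eqP->; split; rewrite ?mulf_neq0 //; ring.
  by rewrite e scale0r add0r => /eqP; rewrite oppr_eq0 scaler_eq0 (negPf d) => /eqP.
have rowP x : x \in [:: x1; x2] ->
    quad (lax2 k1 K) lax_bar1 lax_bar0 (q * x) * ((q * x)%:A + b') = 0.
  move=> hx; have := Px (q * x); rewrite /pencil.
  have [d e] : q * (q * x - x1) * (q * x - x2) != 0
      /\ (q * x - q * x1) * (q * x - q * x2) = 0.
    move: hx; rewrite !inE => /orP[]/eqP->; split; try ring;
      by rewrite !mulf_neq0 // -opprB oppr_eq0.
  by rewrite e scale0r subr0 => /eqP; rewrite scaler_eq0 (negPf d) => /eqP.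
have E2 x : x \in [:: x1; x2] ->
    (b11 + (q * x)%:A) * (F - x%:A) + b12 * image_col K F G2 be x = 0.
  move=> /colP; rewrite quad_laxE blk_scalar /b' blkD blkM blk0.
  case/blk_inj => _ e _ _; apply/eqP; rewrite -oppr_eq0 -e /image_col; apply/eqP.
  by nc tt.
have unf x : x \in [:: x1; x2] -> f - (q * x)%:A \is a GRing.unit.
  by rewrite !inE => /orP[]/eqP->; [exact: (ld_F1 h')|exact: (ld_F2 h')].
have R11 x : x \in [:: x1; x2] -> k1 *: (((q * x)%:A - f) * ((q * x)%:A - al') + g1)
    = (f - (q * x)%:A) * kernel_row q k1 g r0 (q * x).
  by rewrite (ld_G1 h') /kernel_row /r0 !inE => /orP[]/eqP->; nc tt.
have E3 x : x \in [:: x1; x2] ->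
    kernel_row q k1 g r0 (q * x) * V^-1 * ((q * x)%:A + b11) = b21.
  move=> hx; have := rowP _ hx; rewrite quadNE blk_scalar /b' blkD blkM blk0 R11 //.
  case/blk_inj => e _ _ _; apply: (mulrI (unf _ hx)); apply: (mulrI uV).
  apply/eqP; rewrite -subr_eq0 -e; apply/eqP.
  by nc tt.
have E3' x : x \in [:: x1; x2] ->
    kernel_row q k1 g r0 (q * x) * V^-1 * b12 = (q * x)%:A + b22.
  move=> hx; have := rowP _ hx; rewrite quadNE blk_scalar /b' blkD blkM blk0 R11 //.
  case/blk_inj => _ e _ _; apply: (mulrI (unf _ hx)); apply: (mulrI uV).
  apply/eqP; rewrite -subr_eq0 -e; apply/eqP.
  by nc tt.
(* The (1,1) block of the pencil at x = 0. *)
have E4 : const11_lhs f p' V b11 b21 = const11_rhs q c K F G2 be p b11 b12.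
  have := Px 0; rewrite /pencil quadNE quad_laxE !mulr0 !scale0r !sub0r !add0r.
  rewrite !blkM !blkZ blkN blkD blk0 => /blk_inj[e _ _ _].
  apply: (@scalerI _ _ (q * x1 * x2)); first by rewrite !mulf_neq0.
  apply/eqP; rewrite -subr_eq0 -e; apply/eqP.
  by rewrite /const11_lhs /const11_rhs -m21E /p /p'; nc tt.
have LV := fwd_V q0 k10 x12 ug uV uL uN E1 E3'.
have Lb := fwd_b12 q0 k10 x12 ug uV uL uN E1 E3'.
have b11E := fwd_b11 x12 E2.
have gKG : g * K * G2 = (F - x1%:A) * (F - x2%:A).
  exact: fwd_G2 q0 k10 x12 ug uV uL uN E1 E2 E3'.
split=> //.
have r0V := fwd_r0 q0 x12 E3.
have b21E := fwd_b21 q0 x12 E3.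
have := const11_reduce c q0 k10 x10 x20 uF ug uV (ld_GF h') Fp p'E LV Lb b11E gKG r0V b21E.
rewrite E4 subrr !mulr0 mul0r => /esym/eqP.
by rewrite scaler_eq0 !mulf_eq0 (negPf q0) (negPf x10) (negPf x20) /= subr_eq0 => /eqP.
Qed.

(** * Sufficiency: construction of b from the three equations *)

Section Backward.
Hypothesis LV : (1 - g * K) * V = 1 - (q * k1) *: g.
Hypothesis gKG : g * K * G2 = (F - x1%:A) * (F - x2%:A).
Hypothesis eq1 : (1 - (q * k1) *: g) * (r%:A - g) * (f * K * F)
      = q *: ((x1 * x2)%:A - s *: g + (c / (x1 * x2)) *: (g * g)).

(** These are the values forced on the blocks of b in the forward direction. *)
Let b12 := (1 - g * K)^-1 * (q *: g).
Let b11 := q *: F + b12 * K * (F + be) - (x1 + x2) *: (q%:A + b12 * K).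
Let b21 := - ((q^-1 *: g^-1 - k1%:A) * V^-1 * (b11 + (q * x1)%:A) * (b11 + (q * x2)%:A)).
Let b22 := r0 * V^-1 * b12.
Let b := blk b11 b12 b21 b22.

Let Lb : (1 - g * K) * b12 = q *: g.
Proof. by rewrite /b12 mulVKr. Qed.

Let r0V : r0 * V^-1 =
  - ((q^-1 *: g^-1 - k1%:A) * V^-1 * (b11 + (q * (x1 + x2))%:A)).
Proof.
apply: (r0_quotient q0 ug uV LV Lb erefl).
have Fg := Fg_comm q0 k10 uK uG (ld_GF h) (ld_G2 h) gKG u34.
apply: (consistency q0 rn0 x10 x20 uK uF uf ug uG (ld_k1K h) (ld_GF h) (ld_GF h')
  (ld_rc h) (ld_G2 h) LV gKG eq1 erefl _ erefl _ Fg).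
  rewrite (beta_eq h) (ld_G1 h).
  by nc tt.
rewrite (alpha_eq h') (ld_G1 h') (ld_G2 h').
by nc tt.
Qed.

Let pencil_scalars x : x \in [:: x1; x2] ->
  q * (x - x1) * (x - x2) = 0 /\ (q * x - q * x1) * (q * x - q * x2) = 0.
Proof. by rewrite !inE => /orP[]/eqP->; split; ring. Qed.

Let xi x : M := q^-1 *: ((F - (x1 + x2 - x)%:A) * G^-1) - k1 *: (x%:A - al).
Let xi' x : M := kernel_row q k1 g r0 (q * x).

Let swapP x : x \in [:: x1; x2] ->
  x = x1 /\ x1 + x2 - x = x2 \/ x = x2 /\ x1 + x2 - x = x1.
Proof.
by rewrite !inE => /orP[]/eqP->; [left; rewrite addrC addKr | right; rewrite addrK].
Qed.

Let quad_at x : x \in [:: x1; x2] ->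
  quad (lax2 k1 K) (lax1 k1 K F al be gaK) (lax0 k1 K F al be G1 G2 deK) x =
  blk ((F - x%:A) * xi x) (- (F - x%:A))
    (image_col K F G2 be x * xi x) (- image_col K F G2 be x).
Proof.
move=> /swapP hx; rewrite quad_laxE (rank_one_11 h hx) (rank_one_21 h hx) -/(xi x).
by congr blk; rewrite /image_col; nc tt.
Qed.

Let quadN_at x : x \in [:: x1; x2] ->
  quad (lax2 k1 K) lax_bar1 lax_bar0 (q * x) =
  blk (V * (f - (q * x)%:A) * xi' x * V^-1) (- (V * (f - (q * x)%:A)))
    (image_col K f g2 be' (q * x) * xi' x * V^-1) (- image_col K f g2 be' (q * x)).
Proof.
move=> /swapP hx; have hx' : q * x = q * x1 /\ q * (x1 + x2 - x) = q * x2
    \/ q * x = q * x2 /\ q * (x1 + x2 - x) = q * x1.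
  by case: hx => -[-> ->]; [left | right].
have e : q^-1 *: ((f - (q * (x1 + x2 - x))%:A) * g^-1) - k1 *: ((q * x)%:A - al') = xi' x.
  by rewrite /xi' /kernel_row /r0; nc tt.
rewrite quadNE (rank_one_11 h' hx') (rank_one_21 h' hx') e.
by congr blk; rewrite /image_col; nc tt.
Qed.

Let const_eq : lax_bar0 * b = q *: (b * lax0 k1 K F al be G1 G2 deK).
Proof.
have sq := lax0_sqr uF (const21 h) (const22 h).
have sq' := lax0_sqr uf (const21 h') (const22 h').
set L0 := lax0 _ _ _ _ _ _ _ _ in sq *.
set L0' := lax0 _ _ _ _ _ _ _ _ in sq'.
have sqN : lax_bar0 * lax_bar0 = (q * s) *: lax_bar0 - (q ^+ 2 * c)%:A.
  transitivity (u * (L0' * L0') * u^-1).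
    by rewrite /lax_bar0 -/L0' !mulrA mulrVK // -!mulrA.
  by rewrite sq' /lax_bar0 -/L0' mulrBr mulrBl -scalerAr -scalerAl mulr_algr
    -scalerAl mulrV.
have [a [d [y [z SE]]]] := blk_surj (lax_bar0 * b - q *: (b * L0)).
(* In the first row, the (1,1) block vanishes by the equation for F and the (1,2) block by
   [bwd_const2]. *)
have [a0 d0] : a = 0 /\ d = 0.
  move: SE; rewrite /lax_bar0 ui /L0 /lax0 /b !(blkM, blkZ, blkN, blkD).
  move=> /esym/blk_inj[-> -> _ _].
  split.
    have e : g * ((1 - g * K) * (const11_lhs f p' V b11 b21
        - const11_rhs q c K F G2 be p b11 b12)) * F = 0.
      rewrite (const11_reduce c q0 k10 x10 x20 uF ug uV (ld_GF h') Fp p'E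
        LV Lb erefl gKG r0V erefl).
      by rewrite eq1 subrr scaler0.
    have : const11_lhs f p' V b11 b21 - const11_rhs q c K F G2 be p b11 b12 = 0.
      by apply: (mulrI uL); apply: (mulrI ug); apply: (mulIr uF); rewrite e !mulr0 mul0r.
    by move=> e'; rewrite -[RHS]e' /const11_lhs /const11_rhs -m21E /p /p'; nc tt.
  have e := bwd_const2 q0 k10 ug uV uL p'E LV Lb (erefl : b11 = _) gKG (erefl : b22 = _).
  transitivity (V * p' * V^-1 * b12 - V * f * b22
     - q *: (b12 * (K * (G2 + be * F)) - b11 * F)); last by rewrite e subrr.
  by rewrite /p'; nc tt.
move: SE; rewrite {}a0 {}d0; set S := lax_bar0 * b - _ => SE.
have NS : lax_bar0 * S = (q * s) *: S - q *: (S * L0) := quadratic_intertwine b sqN sq.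
rewrite SE /lax_bar0 ui /L0' /lax0 !(blkM, blkZ, blkN, blkD) in NS.
case/blk_inj: NS => e1 e2 _ _.
(* The upper right block of [lax_bar0] is [- V f], so the first row of [NS] forces [y] and [z] to
   vanish. *)
have Vf0 w : V * f * w = 0 -> w = 0.
  by rewrite -mulrA => e; apply: (mulrI uf); apply: (mulrI uV); rewrite e !mulr0.
have y0 : y = 0.
  apply: Vf0; apply/eqP; rewrite -oppr_eq0; apply/eqP.
  by move: e1; rewrite !(mul0r, mulr0, mul1r, mulr1, addr0, add0r, scaler0, subrr,
    mulrN, mulNr, oppr0).
have z0 : z = 0.
  apply: Vf0; apply/eqP; rewrite -oppr_eq0; apply/eqP.
  by move: e2; rewrite !(mul0r, mulr0, mul1r, mulr1, addr0, add0r, scaler0, subrr,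
    mulrN, mulNr, oppr0).
by apply/eqP; rewrite -subr_eq0; apply/eqP; rewrite -[LHS]/S SE y0 z0 -blk0.
Qed.

Lemma equations_pencil_eq0 : exists b, forall x, lax_pencil b x = 0.
Proof.
exists b; apply: (pencil_eq0 (xs := [:: 0; x1; x2; q * x1; q * x2]) _ _ _).1 => //.
  have ne (y z : C) : y - z != 0 -> (y == z) = false by rewrite subr_eq0 => /negPf.
  rewrite /= !inE !(eq_sym 0) !mulf_eq0 (inj_eq (mulfI q0)).
  by rewrite (negPf q0) (negPf x10) (negPf x20)
    (ne _ _ x12) (ne _ _ x1q1) (ne _ _ x1q2) (ne _ _ x2q1) (ne _ _ x2q2).
move=> x; rewrite inE => /orP[/eqP-> | hx].
  rewrite /pencil !mulr0 !scale0r !add0r.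
  have e : quad (lax2 k1 K) lax_bar1 lax_bar0 0 = lax_bar0
    by rewrite /quad expr0n !scale0r !add0r.
  have e' : quad (lax2 k1 K) (lax1 k1 K F al be gaK) (lax0 k1 K F al be G1 G2 deK) 0
    = lax0 k1 K F al be G1 G2 deK by rewrite /quad expr0n !scale0r !add0r.
  rewrite e e' const_eq scalerA -scalerBl; apply/eqP; rewrite scaler_eq0; apply/orP; left.
  by apply/eqP; ring.
have {hx} [y hy [->|->]] : exists2 y, y \in [:: x1; x2] & x = y \/ x = q * y.
  move: hx; rewrite !inE => /or4P[]/eqP->; [exists x1|exists x2|exists x1|exists x2];
    rewrite ?inE ?eqxx ?orbT; by [|left|right].
- rewrite /pencil (pencil_scalars hy).1 scale0r sub0r quad_at // blk_scalar /b blkD blkM.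
  have c1 := bwd_col1 ug uL Lb (erefl : b11 = _) gKG hy.
  have c2 := bwd_col2 q0 ug uV uL LV Lb (erefl : b11 = _) gKG r0V
    (erefl : b21 = _) (erefl : b22 = _) hy.
  apply/eqP; rewrite oppr_eq0 scaler_eq0; apply/orP; right; apply/eqP.
  rewrite blk0; congr blk.
  + transitivity (((b11 + (q * y)%:A) * (F - y%:A) + b12 * image_col K F G2 be y) * xi y).
      by nc tt.
    by rewrite c1 mul0r.
  + transitivity (- ((b11 + (q * y)%:A) * (F - y%:A) + b12 * image_col K F G2 be y)).
      by nc tt.
    by rewrite c1 oppr0.
  + transitivity ((b21 * (F - y%:A) + (b22 + (q * y)%:A) * image_col K F G2 be y) * xi y).
      by nc tt.
    by rewrite c2 mul0r.
  + transitivity (- (b21 * (F - y%:A) + (b22 + (q * y)%:A) * image_col K F G2 be y)).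
      by nc tt.
    by rewrite c2 oppr0.
- rewrite /pencil (pencil_scalars hy).2 scale0r subr0 quadN_at // blk_scalar /b blkD blkM.
  have c1 := bwd_row1 q0 r0V (erefl : b21 = _) hy.
  have c2 := bwd_row2 q0 ug uV LV Lb (erefl : b22 = _) y.
  apply/eqP; rewrite scaler_eq0; apply/orP; right; apply/eqP.
  rewrite blk0; congr blk.
  + transitivity (V * (f - (q * y)%:A) * (xi' y * V^-1 * ((q * y)%:A + b11) - b21)).
      by nc tt.
    by rewrite c1 subrr mulr0.
  + transitivity (V * (f - (q * y)%:A) * (xi' y * V^-1 * b12 - ((q * y)%:A + b22))).
      by nc tt.
    by rewrite c2 subrr mulr0.
  + transitivity (image_col K f g2 be' (q * y) * (xi' y * V^-1 * ((q * y)%:A + b11) - b21)).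
      by nc tt.
    by rewrite c1 subrr mulr0.
  + transitivity (image_col K f g2 be' (q * y) * (xi' y * V^-1 * b12 - ((q * y)%:A + b22))).
      by nc tt.
    by rewrite c2 subrr mulr0.
Qed.
End Backward.
End PencilBlocks.

(** * The stated equations and their forms without denominators *)

Section QuotientForms.
Variables (C : fieldType) (A : unitAlgType C).
Variables (q k1 r s c x1 x2 x3 x4 k u1 u2 : C) (K F G G2 f g W W' : A).
Hypotheses (q0 : q != 0) (k10 : k1 != 0).
Hypotheses (uK : K \is a GRing.unit) (uW : W \is a GRing.unit).
Hypotheses (uF3 : F - x3%:A \is a GRing.unit) (uF4 : F - x4%:A \is a GRing.unit).
Hypotheses (ugv : g - ((q * k1)^-1)%:A \is a GRing.unit)
  (ugr : g - r%:A \is a GRing.unit) (ugK : g - K^-1 \is a GRing.unit).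

Ltac nc H := nc_field C A H.

(** A rewriting rule for [nc_field]: it removes [X] to the left of its resolvent, as in a partial
    fraction expansion. *)
Lemma resolventl (X : A) a : X - a%:A \is a GRing.unit ->
  X * (X - a%:A)^-1 = a *: (X - a%:A)^-1 + 1.
Proof.
move=> u; rewrite -{1}[X](subrK a%:A) mulrDl mulrV // addrC.
by rewrite -scalerAl mul1r.
Qed.

Lemma resolventr (X : A) a : X - a%:A \is a GRing.unit ->
  (X - a%:A)^-1 * X = a *: (X - a%:A)^-1 + 1.
Proof.
move=> u; rewrite -{2}[X](subrK a%:A) mulrDr mulVr // addrC.
by rewrite -scalerAr mulr1.
Qed.

Lemma unit_1BgK : 1 - g * K \is a GRing.unit.
Proof.
have -> : 1 - g * K = - ((g - K^-1) * K) by nc (mulVr uK, tt).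
by rewrite unitrN unitrMl.
Qed.

Lemma unit_1Bqk1g : 1 - (q * k1) *: g \is a GRing.unit.
Proof.
have -> : 1 - (q * k1) *: g = (- (q * k1)) *: (g - ((q * k1)^-1)%:A) by nc tt.
by rewrite scaler_unit ?unitfE ?oppr_eq0 ?mulf_neq0.
Qed.

(** The premises are Vieta's relations: [u1] and [u2] are the roots of the quadratic in [g] on the
    right of the cleared equation. *)
Lemma eq_f_iff : k * k1 * (u1 * u2) = x1 * x2 -> k * k1 * (u1 + u2) = s ->
    k * k1 = c / (x1 * x2) ->
  f * K * F = k *: ((g - u1%:A) * (g - u2%:A) * (g - ((q * k1)^-1)%:A)^-1
                     * (g - r%:A)^-1) <->
  (1 - (q * k1) *: g) * (r%:A - g) * (f * K * F)
    = q *: ((x1 * x2)%:A - s *: g + (c / (x1 * x2)) *: (g * g)).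
Proof.
move=> <- <- <-.
have gd := resolventl ugv; have ge := resolventl ugr.
set d := (g - ((q * k1)^-1)%:A)^-1 in gd *; set e := (g - r%:A)^-1 in ge *.
have h : (1 - (q * k1) *: g) * (r%:A - g) * (k *: ((g - u1%:A) * (g - u2%:A) * d * e)) =
    q *: ((k * k1 * (u1 * u2))%:A - (k * k1 * (u1 + u2)) *: g + (k * k1) *: (g * g)).
  by nc (gd, (ge, tt)).
split=> [->//|]; rewrite -h => e1.
have e2 Z : (1 - (q * k1) *: g) * ((g - r%:A) * Z) =
    - ((1 - (q * k1) *: g) * (r%:A - g) * Z) by nc tt.
by apply: (mulrI ugr); apply: (mulrI unit_1Bqk1g); rewrite !e2 e1.
Qed.

Lemma eq_g_iff : G2 = (q * k1) *: (G * (F - x3%:A) * (F - x4%:A)) ->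
  g * K * G = (q * k1)^-1 *: ((F - x1%:A) * (F - x2%:A) * (F - x3%:A)^-1 * (F - x4%:A)^-1)
  <-> g * K * G2 = (F - x1%:A) * (F - x2%:A).
Proof.
move=> ->; have dF := resolventr uF3; have eF := resolventr uF4.
set d := (F - x3%:A)^-1 in dF *; set e := (F - x4%:A)^-1 in eF *.
have h : g * K * ((q * k1) *: (G * (F - x3%:A) * (F - x4%:A))) =
    (q * k1) *: (g * K * G) * (F - x3%:A) * (F - x4%:A) by nc tt.
have h' : (q * k1) *: ((q * k1)^-1 *: ((F - x1%:A) * (F - x2%:A) * d * e))
   * (F - x3%:A) * (F - x4%:A) = (F - x1%:A) * (F - x2%:A).
  by nc (dF, (eF, tt)).
split=> [e1|]; first by rewrite h e1 h'.
rewrite h -[in RHS]h' => /(mulIr uF4)/(mulIr uF3) /scalerI; apply.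
by rewrite mulf_neq0.
Qed.

Lemma eq_W_iff :
  W^-1 * W' = (q * k1) *: ((g - K^-1)^-1 * (g - ((q * k1)^-1)%:A) * K^-1) <->
  (1 - g * K) * ((W * K)^-1 * (W' * K)) = 1 - (q * k1) *: g.
Proof.
rewrite [(W * K)^-1]invrM //.
have h : (1 - g * K) * (K^-1 * W^-1 * (W' * K)) = - ((g - K^-1) * (W^-1 * W') * K).
  by nc (mulVr uK, (mulrV uK, tt)).
have h' : - ((g - K^-1) * ((q * k1) *: ((g - K^-1)^-1 * (g - ((q * k1)^-1)%:A) * K^-1)) * K)
    = 1 - (q * k1) *: g.
  rewrite -scalerAr !mulrA mulrV // mul1r -scalerAl mulrVK //.
  by nc tt.
split=> [e|]; first by rewrite h e h'.
by rewrite h -h' => /oppr_inj /(mulIr uK) /(mulrI ugK).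
Qed.
End QuotientForms.

Section GaugeForm.
Variables (C : fieldType) (m' : nat).
Notation M := (mxalg C m').
Variables (k1 x : C) (K F G1 G2 al be ga de w : M).
Hypotheses (uK : K \is a GRing.unit) (uw : w \is a GRing.unit).
Ltac nc H := nc_field C (mxalg C m') H.

(** The lower left block receives [K^-1 w^-1] from [D^-1], which is why the data carry the products
    of gamma and delta with [K]. *)
Lemma lax_gauge : let D := blk (w * K) 0 0 1 in
  blk (w * K * (k1 *: ((x%:A - F) * (x%:A - al)) + k1 *: G1) * K^-1 * w^-1)
      (w * K * (x%:A - F))
      (k1 *: ((x *: ga + de) * w^-1))
      (K * (x%:A - be) * (x%:A - F) + K * G2)
  = D * quad (lax2 k1 K) (lax1 k1 K F al be (ga * K))
          (lax0 k1 K F al be G1 G2 (de * K)) x * D^-1.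
Proof.
move=> D; have uwK : w * K \is a GRing.unit by rewrite unitrMl.
rewrite (blk_diag_unit uwK).2 invrM // quad_laxE !blkM; congr blk;
by nc (mulrV uK, tt).
Qed.
End GaugeForm.

(** * The parametrized Lax matrix *)

Lemma diag_mx_unit (C : fieldType) n (d : 'rV[C]_n) :
  (forall i, d 0 i != 0) -> diag_mx d \in unitmx.
Proof.
move=> h; rewrite unitmxE det_diag unitfE.
by apply/prodf_neq0 => i _; exact: h.
Qed.

Section Params.
Variables (C : fieldType) (m' : nat) (p : qpvi_params C) (t : C).
Hypotheses (th10 : theta1 p != 0) (th20 : theta2 p != 0) (k10 : kappa1 p != 0)
  (k20 : kappa2 p != 0) (k30 : kappa3 p != 0).
Hypotheses (k12 : kappa1 p != kappa2 p) (k13 : kappa1 p != kappa3 p).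
Hypotheses (q0 : q p != 0).
Hypotheses (a10 : a1 p != 0) (a20 : a2 p != 0) (a30 : a3 p != 0) (a40 : a4 p != 0).

Lemma Kmx_unit : (Kmx p : 'M[C]_m'.+1) \is a GRing.unit.
Proof. by apply: diag_mx_unit => i; rewrite mxE; case: ifP. Qed.

Lemma kappa1_Kmx_unit : (kappa1 p)%:M - (Kmx p : 'M[C]_m'.+1) \is a GRing.unit.
Proof.
rewrite -diag_const_mx -raddfB; apply: diag_mx_unit => i; rewrite !mxE.
by case: ifP => _; rewrite subr_eq0.
Qed.

Lemma rho_neq0 : rho p != 0.
Proof. by rewrite /rho !mulf_neq0 ?invr_eq0 ?mulf_neq0. Qed.

Lemma prod_alphas : \prod_(a <- alphas p t) ('X - a%:P) =
  Poly [:: (a1 p * t) * (a2 p * t) * a3 p * a4 p;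
     - (a1 p * t * (a2 p * t) * a3 p + a1 p * t * (a2 p * t) * a4 p
        + a1 p * t * a3 p * a4 p + a2 p * t * a3 p * a4 p);
     a1 p * t * (a2 p * t) + a1 p * t * a3 p + a1 p * t * a4 p
       + a2 p * t * a3 p + a2 p * t * a4 p + a3 p * a4 p;
     - (a1 p * t + a2 p * t + a3 p + a4 p); 1].
Proof.
rewrite /alphas !big_cons big_nil /= !cons_poly_def mul0r add0r.
rewrite !(polyCN, polyCD, polyCM); ring.
Qed.

Lemma beta1E : beta_ p t 1 = - (a1 p * t + a2 p * t + a3 p + a4 p).
Proof. by rewrite /beta_ prod_alphas coef_Poly. Qed.

Lemma beta2E : beta_ p t 2 = a1 p * t * (a2 p * t) + a1 p * t * a3 p + a1 p * t * a4 p
       + a2 p * t * a3 p + a2 p * t * a4 p + a3 p * a4 p.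
Proof. by rewrite /beta_ prod_alphas coef_Poly. Qed.

Lemma scalar_mxalg (a : C) : a%:M = (a%:A : mxalg C m').
Proof. by rewrite -[a%:A]/(a *: 1%:M : 'M[C]_m'.+1) scalemx1. Qed.

Lemma lax_data_of_params (F G : 'M[C]_m'.+1) :
  F \is a GRing.unit -> G \is a GRing.unit -> F^-1 * G * F * G^-1 = rho p *: Kmx p ->
  F - (a1 p * t)%:M \is a GRing.unit -> F - (a2 p * t)%:M \is a GRing.unit ->
  @lax_data C (mxalg C m') (q p) (kappa1 p) (rho p) ((theta1 p + theta2 p) * t)
    (t ^+ 2 * theta1 p * theta2 p) (a1 p * t) (a2 p * t) (a3 p) (a4 p)
    (Kmx p) F G (G1 p t F G) (G2 p F G) (balpha p t F G) (bbeta p t F G)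
    (bgamma p t F G * Kmx p) (bdelta p t F G * Kmx p).
Proof.
move=> uF uG FG uF1 uF2; have uK := Kmx_unit.
split => //.
- exact: rho_neq0.
- by rewrite -scalar_mxalg; exact: kappa1_Kmx_unit.
- by rewrite -scalar_mxalg.
- by rewrite -scalar_mxalg.
- have -> : G * F = F * (F^-1 * G * F * G^-1) * G.
    by rewrite !mulrA mulrV // mul1r mulrVK.
  by rewrite FG -scalerAr -scalerAl.
- by rewrite /rho; field; rewrite th10 th20.
- by rewrite /G1 !scalar_mxalg.
- by rewrite /G2 !scalar_mxalg.
- by rewrite /balpha beta1E !scalar_mxalg.
- by rewrite /bbeta beta1E !scalar_mxalg.
- by rewrite /bgamma mulrVK // beta1E beta2E scalar_mxalg.
- by rewrite /bdelta -scalerAl mulrVK.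
Qed.

Lemma laxA_gauge (F G W : C -> 'M[C]_m'.+1) x : W t \is a GRing.unit ->
  laxA p F G W x t =
  let K : mxalg C m' := Kmx p in let D := blk (W t * K) 0 0 1 in
  let f := F t in let g := G t in
  let al := balpha p t f g in let be := bbeta p t f g in
  D * quad (lax2 (kappa1 p) K) (lax1 (kappa1 p) K f al be (bgamma p t f g * K))
        (lax0 (kappa1 p) K f al be (G1 p t f g) (G2 p f g) (bdelta p t f g * K)) x
    * D^-1.
Proof.
move=> uW /=; rewrite -(lax_gauge _ _ _ _ _ _ _ _ _ Kmx_unit uW).
by rewrite /laxA !scalar_mxalg.
Qed.
End Params.

(** * The equivalence for one pair of times t, q t *)

Lemma lax_compat_iff (C : numFieldType) (m' : nat) (p : qpvi_params C)
  (F G W : C -> 'M[C]_m'.+1) (t : C) : let t' := q p * t in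
  0 < `|q p| < 1 -> t != 0 ->
  0 \notin thetas p ++ kappas p ++ as_ p -> uniq (kappas p) ->
  uniq (alphas p t) ->
  (forall i j : 'I_4, i != j -> q p * (alphas p t)`_i != (alphas p t)`_j) ->
  F t \is a GRing.unit -> F t' \is a GRing.unit ->
  G t \is a GRing.unit -> G t' \is a GRing.unit ->
  W t \is a GRing.unit -> W t' \is a GRing.unit ->
  (F t)^-1 * G t * F t * (G t)^-1 = rho p *: Kmx p ->
  (F t')^-1 * G t' * F t' * (G t')^-1 = rho p *: Kmx p ->
  (forall a, a \in alphas p t -> F t - a%:M \is a GRing.unit) ->
  (forall a, a \in alphas p t' -> F t' - a%:M \is a GRing.unit) ->
  G t' - ((q p * kappa1 p)^-1)%:M \is a GRing.unit ->
  G t' - (rho p)%:M \is a GRing.unit ->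
  G t' - (Kmx p)^-1 \is a GRing.unit ->
  (exists B0 : 'M[C]_(m'.+1 + m'.+1),
     forall x, x \notin poleB p t -> q p * x \notin poleB p t ->
       laxA p F G W x t' *m laxB p B0 x t
       = laxB p B0 (q p * x) t *m laxA p F G W x t)
  <->
  [/\ F t' * Kmx p * F t
      = (theta1 p * theta2 p / (kappa1 p * a1 p * a2 p)) *:
          ((G t' - (t * (a1 p * a2 p / theta1 p))%:M)
           * (G t' - (t * (a1 p * a2 p / theta2 p))%:M)
           * (G t' - ((q p * kappa1 p)^-1)%:M)^-1
           * (G t' - (rho p)%:M)^-1),
      G t' * Kmx p * G t
      = (q p * kappa1 p)^-1 *:
          ((F t - (a1 p * t)%:M) * (F t - (a2 p * t)%:M)
           * (F t - (a3 p)%:M)^-1 * (F t - (a4 p)%:M)^-1)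
    & (W t)^-1 * W t'
      = (q p * kappa1 p) *:
          ((G t' - (Kmx p)^-1)^-1
           * (G t' - ((q p * kappa1 p)^-1)%:M)
           * (Kmx p)^-1)].
Proof.
move=> t' /andP[q_gt0 q_lt1] t0 par0 /= ukap ual alq uF uF' uG uG' uW uW' FG FG' Fal Fal'
  ugv ugr ugK.
have q0 : q p != 0 by rewrite -normr_gt0.
have q1 : q p != 1 by apply: contraTneq q_lt1 => ->; rewrite normr1 Order.POrderTheory.ltxx.
have [th10 th20 k10 k20 k30] : [/\ theta1 p != 0, theta2 p != 0, kappa1 p != 0,
    kappa2 p != 0 & kappa3 p != 0].
  by split; apply: contraNneq par0 => e; rewrite /= !inE e eqxx ?orbT.
have [a10 a20 a30 a40] : [/\ a1 p != 0, a2 p != 0, a3 p != 0 & a4 p != 0].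
  by split; apply: contraNneq par0 => e; rewrite /= !inE e eqxx ?orbT.
have [k12 k13] : kappa1 p != kappa2 p /\ kappa1 p != kappa3 p.
  by move: ukap; rewrite !inE negb_or => /andP[/andP[-> ->]].
have a12 : a1 p * t != a2 p * t.
  by move: ual; rewrite /= !inE negb_or => /andP[/andP[]].
have /= a12q := alq (@Ordinal 4 0 isT) (@Ordinal 4 1 isT) isT.
have /= a21q := alq (@Ordinal 4 1 isT) (@Ordinal 4 0 isT) isT.
set x1 := a1 p * t in a12 a21q a12q *; set x2 := a2 p * t in a12 a21q a12q *.
have x10 : x1 != 0 by rewrite mulf_neq0.
have x20 : x2 != 0 by rewrite mulf_neq0.
have qx y : y != 0 -> y - q p * y != 0.
  by move=> y0; rewrite -{1}[y]mul1r -mulrBl mulf_neq0 // subr_eq0 eq_sym.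
have x12 : x1 - x2 != 0 by rewrite subr_eq0.
have x1q2 : x1 - q p * x2 != 0 by rewrite subr_eq0 eq_sym.
have x2q1 : x2 - q p * x1 != 0 by rewrite subr_eq0 eq_sym.
have mem1 u : a1 p * u \in alphas p u by rewrite inE eqxx.
have mem2 u : a2 p * u \in alphas p u by rewrite !inE eqxx orbT.
have data := lax_data_of_params th10 th20 k10 k20 k30 k12 k13 q0 a10 a20 a30 a40.
have h := data m' t _ _ uF uG FG (Fal _ (mem1 t)) (Fal _ (mem2 t)).
have := data m' t' _ _ uF' uG' FG' (Fal' _ (mem1 t')) (Fal' _ (mem2 t')).
rewrite (_ : (theta1 p + theta2 p) * t' = q p * ((theta1 p + theta2 p) * t));
  last by rewrite /t'; ring.
rewrite (_ : t' ^+ 2 * theta1 p * theta2 p = q p ^+ 2 * (t ^+ 2 * theta1 p * theta2 p));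
  last by rewrite /t'; ring.
rewrite (_ : a1 p * t' = q p * x1); last by rewrite /t' /x1; ring.
rewrite (_ : a2 p * t' = q p * x2); last by rewrite /t' /x2; ring.
rewrite -/x1 -/x2 in h.
move=> h'.
have uK : (Kmx p : mxalg C m') \is a GRing.unit := Kmx_unit m' k20 k30.
pose V : mxalg C m' := (W t * Kmx p)^-1 * (W t' * Kmx p).
have uV : V \is a GRing.unit by rewrite unitrMl ?unitrV ?unitrMl.
rewrite !(scalar_mxalg m') in ugv ugr.
have uL := unit_1BgK uK ugK.
have uN := unit_1Bqk1g q0 k10 ugv.
have uF3 : (F t : mxalg C m') - (a3 p)%:A \is a GRing.unit.
  by rewrite -scalar_mxalg Fal // !inE eqxx !orbT.
have uF4 : (F t : mxalg C m') - (a4 p)%:A \is a GRing.unit.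
  by rewrite -scalar_mxalg Fal // !inE eqxx !orbT.
have u34 : ((F t : mxalg C m') - (a3 p)%:A) * (F t - (a4 p)%:A) \is a GRing.unit.
  by rewrite unitrMl.
pose D : 'M[C]_((m' + m'.+1).+1) := blk (W t * Kmx p) 0 0 1.
have uWK : (W t * Kmx p : mxalg C m') \is a GRing.unit by rewrite unitrMl.
have uD : D \is a GRing.unit := (blk_diag_unit uWK).1.
pose K : mxalg C m' := Kmx p.
pose m2 := lax2 (kappa1 p) K.
pose m1 := lax1 (kappa1 p) K (F t) (balpha p t (F t) (G t)) (bbeta p t (F t) (G t))
  (bgamma p t (F t) (G t) * K).
pose m0 := lax0 (kappa1 p) K (F t) (balpha p t (F t) (G t)) (bbeta p t (F t) (G t))
  (G1 p t (F t) (G t)) (G2 p (F t) (G t)) (bdelta p t (F t) (G t) * K).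
pose n1 := lax_bar1 (kappa1 p) K (F t') (balpha p t' (F t') (G t'))
  (bbeta p t' (F t') (G t')) (bgamma p t' (F t') (G t') * K) V.
pose n0 := lax_bar0 (kappa1 p) K (F t') (G1 p t' (F t') (G t')) (G2 p (F t') (G t'))
  (balpha p t' (F t') (G t')) (bbeta p t' (F t') (G t'))
  (bdelta p t' (F t') (G t') * K) V.
have compat (B0 : 'M[C]_((m' + m'.+1).+1)) x : x != 0 ->
    x \notin poleB p t -> q p * x \notin poleB p t ->
    laxA p F G W x t' *m laxB p B0 x t = laxB p B0 (q p * x) t *m laxA p F G W x t
    <-> pencil (q p) x1 x2 m2 m1 m0 n1 n0 (D^-1 * B0 * D) x = 0.
  set b := D^-1 * B0 * D.
  rewrite /poleB !inE !negb_or -!mulrA -/x1 -/x2 !(inj_eq (mulfI q0)) => x0.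
  case/andP=> p1 p2 /andP[p3 p4].
  have nx y : x != y -> x - y != 0 by rewrite subr_eq0.
  have := compat_pencil m2 m1 m0 n1 n0 B0 uD q0 x0 (nx _ p3) (nx _ p4) (nx _ p1) (nx _ p2).
  rewrite -/b.
  have -> : D * quad m2 m1 m0 x * D^-1 = laxA p F G W x t.
    by rewrite (laxA_gauge k20 k30).
  have -> : D * quad m2 n1 n0 x * D^-1 = laxA p F G W x t'.
    have uU := (blk_diag_unit uV).1.
    (* The gauge matrix at time q t is [D] times diag(V, 1), so both sides share the conjugation by
       [D]. *)
    have DU : blk (W t' * Kmx p) 0 0 1 = D * blk V 0 0 1.
      by rewrite /D blkM /V mulVKr // !(mul0r, mulr0, mul1r, addr0, add0r).
    rewrite (laxA_gauge k20 k30) //; cbv zeta.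
    rewrite (quad_conj _ _ (lax2_conj (kappa1 p) K uV)) DU.
    by rewrite invrM // !mulrA.
  have lB y : laxB p B0 y t =
      (y / ((y - q p * x1) * (y - q p * x2))) *: (y%:A + B0) :> 'M_((m' + m'.+1).+1).
    by rewrite /laxB -!mulrA -/x1 -/x2 -scalemx1.
  by rewrite -!lB.
have eqF := @eq_f_iff C (mxalg C m') (q p) (kappa1 p) (rho p) ((theta1 p + theta2 p) * t)
  (t ^+ 2 * theta1 p * theta2 p) x1 x2 (theta1 p * theta2 p / (kappa1 p * a1 p * a2 p))
  (t * (a1 p * a2 p / theta1 p)) (t * (a1 p * a2 p / theta2 p)) (Kmx p) (F t) (F t') (G t')
  q0 k10 ugv ugr.
have {}eqF := eqF (ltac:(by rewrite /x1 /x2; field; rewrite th10 th20 k10 a10 a20))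
  (ltac:(by field; rewrite th10 th20 k10 a10 a20))
  (ltac:(by rewrite /x1 /x2; field; rewrite t0 k10 a10 a20)).
have eqG := @eq_g_iff C (mxalg C m') (q p) (kappa1 p) x1 x2 (a3 p) (a4 p)
  (Kmx p) (F t) (G t) (G2 p (F t) (G t)) (G t') q0 k10 uF3 uF4 (ld_G2 h).
have eqW := @eq_W_iff C (mxalg C m') (q p) (kappa1 p) (Kmx p) (G t') (W t) (W t')
  q0 k10 uK uW ugK.
rewrite !(scalar_mxalg m').
split=> [[B0 hB0]|[/eqF.1 e1 /eqG.1 e2 /eqW.1 e3]].
  (* Five points are taken away from the poles of B(x,t) and B(qx,t), and away from 0, where the
     factor x of B makes the condition empty. *)
  have [xs [uxs sxs xsP]] := @exists_notin C 5
    [:: 0; q p * x1; q p * x2; x1; x2].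
  have hP x : x \in xs -> pencil (q p) x1 x2 m2 m1 m0 n1 n0
      (D^-1 * (B0 : 'M_((m' + m'.+1).+1)) * D) x = 0.
    move/xsP; rewrite !inE !negb_or => /and5P[y0 y1 y2 y3 y4].
    have good : x \notin poleB p t /\ q p * x \notin poleB p t.
      rewrite /poleB !inE !negb_or -!mulrA -/x1 -/x2 !(inj_eq (mulfI q0)).
      by rewrite y1 y2 y3 y4.
    by apply/(compat B0 x y0 good.1 good.2)/hB0; case: good.
  have [e3 e2 e1] := pencil_eq0_equations h h' uV x10 x20 x12 (qx _ x10) x1q2 x2q1
    (qx _ x20) uL uN uxs sxs hP.
  by split; [exact: eqF.2 e1|exact: eqG.2 e2|exact: eqW.2 e3].
have [b hb] := equations_pencil_eq0 h h' uV x10 x20 x12 (qx _ x10) x1q2 x2q1 (qx _ x20)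
  uL u34 e3 e2 e1.
exists (D * b * D^-1) => x good1 good2.
(* At x = 0 both sides vanish through the factor x of B; elsewhere the pencil decides. *)
have [->|x0] := eqVneq x 0.
  by rewrite /laxB mulr0 !mul0r !scale0r mulmx0 mul0mx.
apply/(compat _ _ x0 good1 good2).
by rewrite !mulrA mulVr // mul1r -mulrA mulVr // mulr1; exact: hb.
Qed.

Theorem theorem4p3 (R : realType) (m' : nat) (p : qpvi_params R[i])
  (T : set R[i]) (F G W : R[i] -> 'M[R[i]]_m'.+1)
  (hq : 0 < `|q p| < 1)
  (hT0 : forall t, T t -> t != 0)
  (hTq : forall t, T t -> T (q p * t))
  (hparam0 : 0 \notin thetas p ++ kappas p ++ as_ p)
  (hparam : kappa1 p ^+ m'.+1 * kappa2 p ^+ m' * kappa3 p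
              * \prod_(a <- as_ p) a ^+ m'.+1
            = theta1 p ^+ m'.+1 * theta2 p ^+ m'.+1)
  (htheta : uniq (thetas p))
  (hkappa : uniq (kappas p))
  (hthetaq : forall x y, x \in thetas p -> y \in thetas p ->
     forall n : nat, (0 < n)%N -> y / x != q p ^+ n)
  (hkappaq : forall x y, x \in kappas p -> y \in kappas p ->
     forall n : nat, (0 < n)%N -> y / x != q p ^+ n)
  (halpha : forall t, T t -> uniq (alphas p t))
  (halphaq : forall t, T t -> forall i j : 'I_4, i != j ->
     q p * (alphas p t)`_i != (alphas p t)`_j)
  (hF : forall t, T t -> F t \is a GRing.unit)
  (hG : forall t, T t -> G t \is a GRing.unit)
  (hW : forall t, T t -> W t \is a GRing.unit)
  (hFG : forall t, T t -> (F t)^-1 * G t * F t * (G t)^-1 = rho p *: Kmx p)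
  (hFalpha : forall t, T t -> forall a, a \in alphas p t ->
     F t - a%:M \is a GRing.unit)
  (hGkappa1 : forall t, T t ->
     G (q p * t) - ((q p * kappa1 p)^-1)%:M \is a GRing.unit)
  (hGrho : forall t, T t -> G (q p * t) - (rho p)%:M \is a GRing.unit)
  (hGK : forall t, T t -> G (q p * t) - (Kmx p)^-1 \is a GRing.unit)
  (t : R[i]) (ht : T t) :
  (exists B0 : 'M[R[i]]_(m'.+1 + m'.+1),
     forall x : R[i], x \notin poleB p t -> q p * x \notin poleB p t ->
       laxA p F G W x (q p * t) *m laxB p B0 x t
       = laxB p B0 (q p * x) t *m laxA p F G W x t)
  <->
  [/\ F (q p * t) * Kmx p * F t
      = (theta1 p * theta2 p / (kappa1 p * a1 p * a2 p)) *:
          ((G (q p * t) - (t * (a1 p * a2 p / theta1 p))%:M)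
           * (G (q p * t) - (t * (a1 p * a2 p / theta2 p))%:M)
           * (G (q p * t) - ((q p * kappa1 p)^-1)%:M)^-1
           * (G (q p * t) - (rho p)%:M)^-1),
      G (q p * t) * Kmx p * G t
      = (q p * kappa1 p)^-1 *:
          ((F t - (a1 p * t)%:M) * (F t - (a2 p * t)%:M)
           * (F t - (a3 p)%:M)^-1 * (F t - (a4 p)%:M)^-1)
    & (W t)^-1 * W (q p * t)
      = (q p * kappa1 p) *:
          ((G (q p * t) - (Kmx p)^-1)^-1
           * (G (q p * t) - ((q p * kappa1 p)^-1)%:M)
           * (Kmx p)^-1)].
Proof.
have ht' := hTq t ht.
exact: (@lax_compat_iff R[i] m' p F G W t hq (hT0 t ht) hparam0 hkappa
  (halpha t ht) (halphaq t ht) (hF t ht) (hF _ ht') (hG t ht) (hG _ ht')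
  (hW t ht) (hW _ ht') (hFG t ht) (hFG _ ht') (hFalpha t ht) (hFalpha _ ht')
  (hGkappa1 t ht) (hGrho t ht) (hGK t ht)).
Qed.
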